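(* Let $B=A^{coH}\subseteq A$ be a quantum principal bundle and let $\Omega^\bullet(A)$ be a complete calculus on $A$. Then there is a surjective morphism of differential graded algebras $\pi_{\mathrm{ver}}:\Omega^\bullet(A)\to\mathrm{ver}^\bullet(A)$ extending the identity $\mathrm{id}:A\to A$. It is determined on homogeneous elements by $$\pi_{\mathrm{ver}}|_{\Omega^k(A)}=(\mathrm{id}\otimes(\pi_{inv}\circ\pi_k))\circ\Delta_A^\wedge|_{\Omega^k(A)}:\Omega^k(A)\to\mathrm{ver}^k(A)$$ for all $k>0$, where $\pi_k:\Omega^\bullet(H)\to\Omega^k(H)$ is the projection. Explicitly, $$\pi_{\mathrm{ver}}(a^0\mathrm{d}a^1\wedge\cdots\wedge\mathrm{d}a^k)=a^0_0a^1_0\cdots a^k_0\otimes S(a^0_1a^1_1\cdots a^k_1)a^0_2\,\mathrm{d}a^1_2\wedge\cdots\wedge\mathrm{d}a^k_2$$ for all $a^0,\ldots,a^k\in A$.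
   Context: Work over a field $\mathbb{k}$; $H$ is a Hopf algebra with coproduct $\Delta(h)=h_1\otimes h_2$, counit $\epsilon$, antipode $S$; right coactions are written $a\mapsto a_0\otimes a_1$, iterated $a_0\otimes a_1\otimes a_2$. A differential calculus on an algebra $A$ is a differential $\mathbb{N}_0$-graded algebra $(\Omega^\bullet,\wedge,\mathrm{d})$ with $\Omega^0=A$ and $\Omega^k=\mathrm{span}\{a^0\mathrm{d}a^1\wedge\cdots\wedge\mathrm{d}a^k\}$. Tensor products of differential graded algebras carry the product $(\omega\otimes\eta)(\omega'\otimes\eta')=(-1)^{|\eta||\omega'|}(\omega\wedge\omega')\otimes(\eta\wedge\eta')$ and the differential $\mathrm{d}\otimes\mathrm{id}+(-1)^{|\cdot|}\mathrm{id}\otimes\mathrm{d}$. Standing assumptions: $(\Gamma,\mathrm{d})$ is a bicovariant first order calculus on $H$ and $\Omega^\bullet(H)=\Gamma^\wedge$ its maximal prolongation (tensor algebra of $\Gamma$ over $H$ modulo the ideal generated by $\sum_i\mathrm{d}a^i\otimes_H\mathrm{d}b^i$ whenever $\sum_ia^i\mathrm{d}b^i=0$), such that $\Delta$ extends to a morphism of differential graded algebras $\Delta^\bullet:\Omega^\bullet(H)\to\Omega^\bullet(H)\otimes\Omega^\bullet(H)$. A quantum principal bundle is a faithfully flat Hopf-Galois extension $B=A^{coH}\subseteq A$ of a right $H$-comodule algebra $A$. A differential calculus $\Omega^\bullet(A)$ is complete if $\Delta_A:A\to A\otimes H$ extends to a morphism of differential graded algebras $\Delta_A^\wedge:\Omega^\bullet(A)\to\Omega^\bullet(A)\otimes\Omega^\bullet(H)$.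 $\Lambda^\bullet\subseteq\Omega^\bullet(H)$ is the subalgebra of left $H$-coinvariant forms; $\pi_{inv}:\Omega^\bullet(H)\to\Lambda^\bullet$, $\pi_{inv}(\omega)=S(\omega_{-1})\omega_0$, where $\omega\mapsto\omega_{-1}\otimes\omega_0$ is the left $H$-coaction on $\Omega^\bullet(H)$. $\Lambda^\bullet$ is a right $H$-module via $\theta\leftharpoonup h=S(h_1)\theta h_2$. Put $\pi_\epsilon(h)=h-\epsilon(h)1$ and $\varpi(h)=S(h_1)\mathrm{d}h_2$. Vertical forms are $\mathrm{ver}^\bullet(A)=A\otimes\Lambda^\bullet$ with product $(a\otimes\theta)\wedge_{\mathrm{ver}}(b\otimes\eta)=ab_0\otimes(\theta\leftharpoonup b_1)\wedge\eta$ and differential $\mathrm{d}_{\mathrm{ver}}(a\otimes\theta)=a\otimes\mathrm{d}\theta+a_0\otimes\varpi(\pi_\epsilon(a_1))\wedge\theta$. *)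

(* Defs.v *)
From HB Require Import structures.
From mathcomp Require Import all_boot all_order all_algebra.
From mathcomp Require Import all_classical.
Set Implicit Arguments.
Unset Strict Implicit.
Unset Printing Implicit Defensive.
Import GRing.Theory.
Local Open Scope ring_scope.
Local Open Scope quotient_scope.

Reserved Notation "U \otimes V" (at level 40, left associativity).
Reserved Notation "u \ox v" (at level 40, left associativity).
Reserved Notation "x \w y" (at level 40, left associativity).

(* Finite formal sums of elements of X are lists; [fscong R] is the least
   congruence of commutative monoids that contains R. *)
Inductive fscong (X : Type) (R : seq X -> seq X -> Prop) :
    seq X -> seq X -> Prop :=
| FscBase s t : R s t -> fscong R s t
| FscRefl s : fscong R s s
| FscSym s t : fscong R s t -> fscong R t s
| FscTrans s t u : fscong R s t -> fscong R t u -> fscong R s u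
| FscComm s t : fscong R (s ++ t) (t ++ s)
| FscCat s s' t t' :
    fscong R s s' -> fscong R t t' -> fscong R (s ++ t) (s' ++ t').

Section BalancedTensor.
Variables (S : Type) (U V : zmodType) (ra : U -> S -> U) (la : S -> V -> V).

Inductive tens_rel : seq (U * V) -> seq (U * V) -> Prop :=
| TensDl u u' v : tens_rel [:: (u + u', v)] [:: (u, v); (u', v)]
| TensDr u v v' : tens_rel [:: (u, v + v')] [:: (u, v); (u, v')]
| Tens0 v : tens_rel [:: (0, v)] [::]
| TensBal u s v : tens_rel [:: (ra u s, v)] [:: (u, la s v)].

Definition tens_eqb (s t : seq (U * V)) : bool := `[< fscong tens_rel s t >].

Lemma tens_eqb_refl : reflexive tens_eqb.
Proof. by move=> s; apply/asboolP; apply: FscRefl. Qed.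

Lemma tens_eqb_sym : symmetric tens_eqb.
Proof. by move=> s t; apply/asboolP/asboolP; apply: FscSym. Qed.

Lemma tens_eqb_trans : transitive tens_eqb.
Proof.
by move=> t s u /asboolP st /asboolP tu; apply/asboolP; apply: FscTrans st tu.
Qed.

Canonical tens_equiv :=
  EquivRel tens_eqb tens_eqb_refl tens_eqb_sym tens_eqb_trans.

(* The tensor product of the abelian groups U and V, balanced over S, which
   acts on U from the right by ra and on V from the left by la. *)
Definition tens : Type := {eq_quot tens_equiv}.
HB.instance Definition _ := Choice.on tens.
HB.instance Definition _ := EqQuotient.on tens.

Lemma tens_eqP (s t : seq (U * V)) :
  (\pi_tens s = \pi_tens t) <-> fscong tens_rel s t.
Proof.
split=> [/eqquotP/asboolP //|st]; apply/eqquotP; exact/asboolP.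
Qed.

Lemma tens_repr (s : seq (U * V)) : fscong tens_rel (repr (\pi_tens s)) s.
Proof. by apply/tens_eqP; rewrite reprK. Qed.

Definition tens_zero : tens := \pi_tens [::].
Definition tens_add (x y : tens) : tens := \pi_tens (repr x ++ repr y).
Definition tens_opp (x : tens) : tens :=
  \pi_tens [seq (- p.1, p.2) | p <- repr x].

Lemma tens_piD s t : tens_add (\pi_tens s) (\pi_tens t) = \pi_tens (s ++ t).
Proof. by apply/tens_eqP; apply: FscCat; apply: tens_repr. Qed.

Lemma tens_addA : associative tens_add.
Proof.
elim/(@quotW _ tens)=> s; elim/(@quotW _ tens)=> t; elim/(@quotW _ tens)=> u.
by rewrite !tens_piD catA.
Qed.

Lemma tens_addC : commutative tens_add.
Proof.
elim/(@quotW _ tens)=> s; elim/(@quotW _ tens)=> t; rewrite !tens_piD.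
by apply/tens_eqP; apply: FscComm.
Qed.

Lemma tens_add0 : left_id tens_zero tens_add.
Proof. by elim/(@quotW _ tens)=> s; rewrite tens_piD. Qed.

Lemma tens_addN : left_inverse tens_zero tens_opp tens_add.
Proof.
move=> x; rewrite -{2}[x]reprK /tens_opp tens_piD.
apply/tens_eqP; elim: (repr x) => [|[u v] s IHs]; first exact: FscRefl.
rewrite /=; set s' := map _ s in IHs *.
have h1 : fscong tens_rel [:: (- u, v); (u, v)] [::].
  apply: FscTrans (FscBase (Tens0 v)); apply: FscSym.
  by rewrite -{1}(addNr u); apply: FscBase; apply: TensDl.
have h2 : fscong tens_rel ((- u, v) :: s' ++ (u, v) :: s)
            ([:: (- u, v)] ++ [:: (u, v)] ++ s ++ s').
  by apply: (@FscCat _ _ [:: _] [:: _]); [exact: FscRefl | exact: FscComm].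
apply: FscTrans h2 _; rewrite catA; apply: (@FscCat _ _ _ [::] _ [::] h1).
exact: FscTrans (FscComm _ _ _) IHs.
Qed.

HB.instance Definition _ :=
  GRing.isZmodule.Build tens tens_addA tens_addC tens_add0 tens_addN.

Definition tpure (u : U) (v : V) : tens := \pi_tens [:: (u, v)].

(* tlift f sends the sum of the u_i (x) v_i to the sum of the f u_i v_i; this is
   independent of the chosen representative as soon as f is biadditive and
   balanced (lemma tlift_pure), the only case in which it is meaningful. *)
Definition tlift (W : zmodType) (f : U -> V -> W) (t : tens) : W :=
  \sum_(p <- repr t) f p.1 p.2.

Lemma tens_pi_sum (s : seq (U * V)) : \pi_tens s = \sum_(p <- s) tpure p.1 p.2.
Proof.
elim: s => [|[u v] s IHs]; [rewrite big_nil; exact: erefl|].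
by rewrite big_cons -IHs; apply/esym; exact: tens_piD.
Qed.

Lemma tens_span (t : tens) : exists s : seq (U * V),
  t = \sum_(p <- s) tpure p.1 p.2.
Proof. by exists (repr t); rewrite -tens_pi_sum reprK. Qed.

Section Lift.
Variables (W : zmodType) (f : U -> V -> W).
Hypotheses (fDl : forall u u' v, f (u + u') v = f u v + f u' v)
  (fDr : forall u v v', f u (v + v') = f u v + f u v')
  (fbal : forall u s v, f (ra u s) v = f u (la s v)).

Lemma tlift_cong s t : fscong tens_rel s t ->
  \sum_(p <- s) f p.1 p.2 = \sum_(p <- t) f p.1 p.2.
Proof.
elim=> {s t} [s t r|s|s t _ ->|s t u _ -> _ ->|s t|s s' t t' _ e _ e'] //.
- case: r => [u u' v|u v v'|v|u a v]; rewrite !big_cons !big_nil /= ?addr0 //.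
  by apply: (addIr (f 0 v)); rewrite -fDl addr0 add0r.
- by rewrite !big_cat /= addrC.
- by rewrite !big_cat /= e e'.
Qed.

Lemma tlift_pi s : tlift f (\pi_tens s) = \sum_(p <- s) f p.1 p.2.
Proof. exact/tlift_cong/tens_repr. Qed.

Lemma tlift_pure u v : tlift f (tpure u v) = f u v.
Proof. by rewrite /tpure tlift_pi big_cons big_nil addr0. Qed.

Lemma tliftD : {morph tlift f : s t / s + t}.
Proof.
elim/(@quotW _ tens)=> s; elim/(@quotW _ tens)=> t.
by rewrite [_ + _]tens_piD !tlift_pi big_cat.
Qed.

End Lift.

End BalancedTensor.

Section Tensor.
Variables (k : fieldType).

Definition tensor (U V : lmodType k) : Type :=
  tens (fun (u : U) (c : k) => c *: u) (fun (c : k) (v : V) => c *: v).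
HB.instance Definition _ U V := GRing.Zmodule.on (tensor U V).

Definition tensp (U V : lmodType k) (u : U) (v : V) : tensor U V :=
  tpure (fun u c => c *: u) (fun c v => c *: v) u v.

Section Scale.
Variables (U V : lmodType k).

Definition tensor_scale (c : k) : tensor U V -> tensor U V :=
  tlift (fun u v => tensp (c *: u) v).

Let tenspDl (u u' : U) (v : V) : tensp (u + u') v = tensp u v + tensp u' v.
Proof.
by apply/esym; rewrite [LHS]tens_piD; apply/tens_eqP/FscSym/FscBase; apply: TensDl.
Qed.

Let tenspDr (u : U) (v v' : V) : tensp u (v + v') = tensp u v + tensp u v'.
Proof.
by apply/esym; rewrite [LHS]tens_piD; apply/tens_eqP/FscSym/FscBase; apply: TensDr.
Qed.

Let tenspZ (c : k) (u : U) (v : V) : tensp (c *: u) v = tensp u (c *: v).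
Proof. by apply/tens_eqP/FscBase; apply: TensBal. Qed.

Let scaleD c : {morph tensor_scale c : s t / s + t}.
Proof.
apply: tliftD => [u u' v|u v v'|u b v]; rewrite ?scalerDr ?tenspDl ?tenspDr //.
by rewrite scalerA mulrC -scalerA tenspZ.
Qed.

Let scalep c u v : tensor_scale c (tensp u v) = tensp (c *: u) v.
Proof.
apply: tlift_pure => {u v} [u u' v|u v v'|u b v].
- by rewrite scalerDr tenspDl.
- exact: tenspDr.
- by rewrite scalerA mulrC -scalerA tenspZ.
Qed.

Let scale0 c : tensor_scale c 0 = 0.
Proof. by apply: (addIr (tensor_scale c 0)); rewrite -scaleD !add0r. Qed.

Let tensor_ind (P : tensor U V -> Prop) : P 0 ->
  (forall u v t, P t -> P (tensp u v + t)) -> forall t, P t.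
Proof.
move=> P0 PD t; have [s ->] := tens_span t.
by elim: s => [|p s IHs]; rewrite ?big_nil // big_cons; apply: PD.
Qed.

Let scaleA a b v : tensor_scale a (tensor_scale b v) = tensor_scale (a * b) v.
Proof.
elim/tensor_ind: v => [|u v t IH]; first by rewrite !scale0.
by rewrite !scaleD !scalep scalerA IH.
Qed.

Let scale1 : left_id 1 tensor_scale.
Proof.
elim/tensor_ind=> [|u v t IH]; first by rewrite scale0.
by rewrite scaleD scalep scale1r IH.
Qed.

Let scaleDl v : {morph tensor_scale^~ v : a b / a + b}.
Proof.
move=> a b; elim/tensor_ind: v => [|u v t IH]; first by rewrite !scale0 addr0.
by rewrite !scaleD !scalep IH scalerDl tenspDl addrACA.
Qed.

HB.instance Definition _ :=
  GRing.Zmodule_isLmodule.Build k (tensor U V) scaleA scale1 scaleD scaleDl.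

End Scale.

End Tensor.

Notation "U \otimes V" := (tensor U V) : type_scope.
Notation "u \ox v" := (tensp u v) : ring_scope.

Section TensorMaps.
Variable k : fieldType.

Lemma tenspDl (U V : lmodType k) (u u' : U) (v : V) :
  (u + u') \ox v = u \ox v + u' \ox v.
Proof.
by apply/esym; rewrite [LHS]tens_piD; apply/tens_eqP/FscSym/FscBase; apply: TensDl.
Qed.

Lemma tenspDr (U V : lmodType k) (u : U) (v v' : V) :
  u \ox (v + v') = u \ox v + u \ox v'.
Proof.
by apply/esym; rewrite [LHS]tens_piD; apply/tens_eqP/FscSym/FscBase; apply: TensDr.
Qed.

Lemma tenspZr (U V : lmodType k) (c : k) (u : U) (v : V) :
  u \ox (c *: v) = (c *: u) \ox v.
Proof. by apply/tens_eqP/FscSym/FscBase; apply: TensBal. Qed.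

Lemma tenspZl (U V : lmodType k) (c : k) (u : U) (v : V) :
  (c *: u) \ox v = c *: (u \ox v).
Proof.
apply/esym; apply: tlift_pure => {u v} [u u' v|u v v'|u b v].
- by rewrite scalerDr tenspDl.
- exact: tenspDr.
- by rewrite tenspZr scalerA mulrC -scalerA.
Qed.

Lemma tensp_linearr (U V : lmodType k) (u : U) : linear (@tensp k U V u).
Proof. by move=> c v v'; rewrite tenspDr tenspZr tenspZl. Qed.

Definition tmap (U U' V V' : lmodType k) (f : U -> U') (g : V -> V') :
    U \otimes V -> U' \otimes V' :=
  tlift (fun u v => f u \ox g v).

Definition tassoc (U V W : lmodType k) :
    (U \otimes V) \otimes W -> U \otimes (V \otimes W) :=
  tlift (fun t w => tlift (fun u v => u \ox (v \ox w)) t).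

Definition tmul2 (U U' U'' V V' V'' : lmodType k)
    (m : U -> U' -> U'') (n : V -> V' -> V'')
    (s : U \otimes V) (t : U' \otimes V') : U'' \otimes V'' :=
  tlift (fun u v => tlift (fun u' v' => m u u' \ox n v v') t) s.

End TensorMaps.

Section HopfAlgebras.
Variable k : fieldType.

Record hopf := Hopf {
  hopf_alg :> algType k;
  copr : {linear hopf_alg -> hopf_alg \otimes hopf_alg};
  counit : {linear hopf_alg -> k^o};
  antip : {linear hopf_alg -> hopf_alg};
  coprA : forall h, tassoc (tmap copr id (copr h)) = tmap id copr (copr h);
  counitl : forall h, tlift (fun x y => counit x *: y) (copr h) = h;
  counitr : forall h, tlift (fun x y => counit y *: x) (copr h) = h;
  copr1 : copr 1 = 1 \ox 1;
  coprM : forall g h, copr (g * h) = tmul2 *%R *%R (copr g) (copr h);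
  counit1 : counit 1 = 1;
  counitM : forall g h, counit (g * h) = counit g * counit h;
  antipl : forall h, tlift (fun x y => antip x * y) (copr h) = counit h *: 1;
  antipr : forall h, tlift (fun x y => x * antip y) (copr h) = counit h *: 1
}.

Arguments copr {_}.
Arguments counit {_}.
Arguments antip {_}.

Record comodAlg (H : hopf) := ComodAlg {
  coalg_alg :> algType k;
  coact : {linear coalg_alg -> coalg_alg \otimes H};
  coactA : forall a,
    tassoc (tmap coact id (coact a)) = tmap id copr (coact a);
  coact_counit : forall a, tlift (fun x h => counit h *: x) (coact a) = a;
  coact1 : coact 1 = 1 \ox 1;
  coactM : forall a b, coact (a * b) = tmul2 *%R *%R (coact a) (coact b)
}.

Arguments coact {_ _}.

Section Coinvariants.
Variables (H : hopf) (A : comodAlg H).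

Definition coinv : {pred A} := fun a => `[< coact a = a \ox 1 >].

Lemma coinv_subring : GRing.subring_closed coinv.
Proof.
split=> [|a b /asboolP ea /asboolP eb|a b /asboolP ea /asboolP eb];
  apply/asboolP.
- exact: coact1.
- have nb : (- b) \ox (1 : H) = - (b \ox 1).
    by rewrite -!scaleN1r tenspZl.
  by rewrite linearB /= ea eb tenspDl nb.
- rewrite coactM ea eb /tmul2.
  have e (c d : A) (x y : H) :
      tlift (fun u' v' => (c * u') \ox (x * v')) (d \ox y) = (c * d) \ox (x * y).
    apply: tlift_pure => *; rewrite ?mulrDr ?tenspDl ?tenspDr //.
    by rewrite -!scalerAr tenspZr.
  rewrite /tensp tlift_pure => [|u u' v|u v v'|u s v].
  + by rewrite e mulr1.
  + by rewrite !e mulrDl tenspDl.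
  + by rewrite !e mulrDl tenspDr.
  + by rewrite !e -!scalerAl tenspZr.
Qed.

HB.instance Definition _ := GRing.isSubringClosed.Build A coinv coinv_subring.

Record coinvAlg := CoinvAlg {coinv_val : A; coinv_valP : coinv_val \in coinv}.
HB.instance Definition _ := [isSub for coinv_val].
HB.instance Definition _ := [Choice of coinvAlg by <:].
HB.instance Definition _ := [SubChoice_isSubNzRing of coinvAlg by <:].

Definition tensB (M : lmodType coinvAlg^c) : zmodType :=
  tens (fun (m : M) (b : coinvAlg) => (b : coinvAlg^c) *: m)
       (fun (b : coinvAlg) (a : A) => val b * a).

Definition tensBmap (M N : lmodType coinvAlg^c) (f : M -> N) :
    tensB M -> tensB N :=
  tlift (fun m a => tpure (fun (n : N) (b : coinvAlg) => (b : coinvAlg^c) *: n)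
                          (fun b a => val b * a) (f m) a).

Definition exact_seq (M N P : zmodType) (f : M -> N) (g : N -> P) : Prop :=
  forall y, g y = 0 <-> exists x, f x = y.

(* Right B-modules are left modules over the converse ring B^c. *)
Definition faithfully_flat : Prop :=
  forall (M N P : lmodType coinvAlg^c) (f : {linear M -> N})
         (g : {linear N -> P}),
    exact_seq f g <-> exact_seq (tensBmap f) (tensBmap g).

Definition galois_map :
    tens (fun (a : A) (b : coinvAlg) => a * val b)
         (fun (b : coinvAlg) (a : A) => val b * a) -> A \otimes H :=
  tlift (fun a a' => tlift (fun x h => (a * x) \ox h) (coact a')).

Definition quantum_principal_bundle : Prop :=
  bijective galois_map /\ faithfully_flat.

End Coinvariants.

End HopfAlgebras.

Arguments copr {_ _}.
Arguments counit {_ _}.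
Arguments antip {_ _}.
Arguments coact {_ _ _}.

Section DGA.
Variable k : fieldType.

(* A graded space is given by its total space together with the projections
   dga_gr n on the homogeneous components. dgaOps carries the operations only;
   the axioms are in is_dga. *)
Record dgaOps := DgaOps {
  dga_car :> lmodType k;
  dga_one : dga_car;
  dga_mul : dga_car -> dga_car -> dga_car;
  dga_gr : nat -> dga_car -> dga_car;
  dga_d : dga_car -> dga_car
}.

Local Notation "x \w y" := (dga_mul x y) : ring_scope.

Definition homog (D : dgaOps) (n : nat) (x : D) : Prop := dga_gr n x = x.

Record is_dga (D : dgaOps) : Prop := IsDga {
  dga_mul_linl : forall y : D, linear (fun x : D => x \w y);
  dga_mul_linr : forall x : D, linear (fun y : D => x \w y);
  dga_mulA : forall x y z : D, x \w (y \w z) = (x \w y) \w z;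
  dga_mul1l : forall x : D, dga_one D \w x = x;
  dga_mul1r : forall x : D, x \w dga_one D = x;
  dga_gr_lin : forall n, linear (@dga_gr D n);
  dga_gr_idem : forall m n (x : D),
    dga_gr m (dga_gr n x) = if m == n then dga_gr n x else 0;
  dga_gr_sum : forall x : D, exists N, x = \sum_(n < N) dga_gr n x;
  dga_one_homog : homog 0 (dga_one D);
  dga_mul_homog : forall m n (x y : D),
    homog m x -> homog n y -> homog (m + n)%N (x \w y);
  dga_d_lin : linear (@dga_d D);
  dga_d_homog : forall n (x : D), homog n x -> homog n.+1 (dga_d x);
  dga_dd : forall x : D, dga_d (dga_d x) = 0;
  dga_leibniz : forall n (x y : D), homog n x ->
    dga_d (x \w y) = dga_d x \w y + (-1) ^+ n *: (x \w dga_d y)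
}.

Record dga := Dga { dga_ops :> dgaOps; dga_ax : is_dga dga_ops }.

Record dga_morphism (D E : dgaOps) (f : D -> E) : Prop := DgaMorphism {
  dgam_lin : linear f;
  dgam_one : f (dga_one D) = dga_one E;
  dgam_mul : forall x y, f (x \w y) = f x \w f y;
  dgam_gr : forall n x, f (dga_gr n x) = dga_gr n (f x);
  dgam_d : forall x, f (dga_d x) = dga_d (f x)
}.

(* The sums over all degrees below have finite support. *)
Definition tensor_dga (D E : dga) : dgaOps :=
  @DgaOps (D \otimes E)
    (dga_one D \ox dga_one E)
    (fun s t => tlift (fun w e => tlift (fun w' e' =>
        \sum_(p \in [set: nat]) \sum_(q \in [set: nat])
          (-1) ^+ (p * q) *:
            ((w \w dga_gr q w') \ox (dga_gr p e \w e'))) t) s)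
    (fun n => tlift (fun w e =>
        \sum_(p < n.+1) dga_gr p w \ox dga_gr (n - p) e))
    (tlift (fun w e => dga_d w \ox e +
        \sum_(p \in [set: nat]) (-1) ^+ p *: (dga_gr p w \ox dga_d e))).

(* a0 d a1 /\ ... /\ d an, where iota embeds the algebra in degree 0 *)
Definition dform (A : Type) (D : dgaOps) (iota : A -> D) (a0 : A) (s : seq A) :
    D :=
  foldl (fun w a => w \w dga_d (iota a)) (iota a0) s.

(* A differential calculus on A: cal_in identifies A with the component of
   degree 0, with inverse the restriction of cal_pr. *)
Record calculus (A : algType k) := Calculus {
  cal_dga :> dga;
  cal_in : {linear A -> cal_dga};
  cal_pr : {linear cal_dga -> A};
  cal_in1 : cal_in 1 = dga_one cal_dga;
  cal_inM : forall a b, cal_in (a * b) = cal_in a \w cal_in b;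
  cal_inK : forall a, cal_pr (cal_in a) = a;
  cal_prK : forall w, cal_in (cal_pr w) = dga_gr 0 w;
  cal_span : forall n (w : cal_dga), homog n w ->
    exists r : seq (A * n.-tuple A),
      w = \sum_(p <- r) dform cal_in p.1 p.2
}.

End DGA.

Notation "x \w y" := (dga_mul x y) : ring_scope.

Section FirstOrder.
Variable k : fieldType.

Record fodc (H : algType k) := Fodc {
  fo_car :> lmodType k;
  fo_l : H -> fo_car -> fo_car;
  fo_r : fo_car -> H -> fo_car;
  fo_d : {linear H -> fo_car};
  fo_l_linl : forall x, linear (fun h => fo_l h x);
  fo_l_linr : forall h, linear (fo_l h);
  fo_r_linl : forall h, linear (fun x => fo_r x h);
  fo_r_linr : forall x, linear (fo_r x : H -> fo_car);
  fo_l1 : forall x, fo_l 1 x = x;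
  fo_lM : forall g h x, fo_l (g * h) x = fo_l g (fo_l h x);
  fo_r1 : forall x, fo_r x 1 = x;
  fo_rM : forall x g h, fo_r x (g * h) = fo_r (fo_r x g) h;
  fo_lr : forall g x h, fo_r (fo_l g x) h = fo_l g (fo_r x h);
  fo_leibniz : forall g h, fo_d (g * h) = fo_r (fo_d g) h + fo_l g (fo_d h);
  fo_span : forall x, exists r : seq (H * H),
    x = \sum_(p <- r) fo_l p.1 (fo_d p.2)
}.

Definition left_covariant (H : hopf k) (G : fodc H)
    (lam : {linear G -> H \otimes G}) : Prop :=
  [/\ forall x, tassoc (tmap (@copr k H) id (lam x)) = tmap id lam (lam x),
      forall x, tlift (fun h y => counit h *: y) (lam x) = x,
      forall h x, lam (fo_l h x) = tmul2 *%R (@fo_l _ G) (copr h) (lam x),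
      forall x h, lam (fo_r x h) = tmul2 *%R (@fo_r _ G) (lam x) (copr h) &
      forall h, lam (fo_d G h) = tmap id (@fo_d _ G) (copr h)].

Definition right_covariant (H : hopf k) (G : fodc H)
    (rho : {linear G -> G \otimes H}) : Prop :=
  [/\ forall x, tassoc (tmap rho id (rho x)) = tmap id (@copr k H) (rho x),
      forall x, tlift (fun y h => counit h *: y) (rho x) = x,
      forall h x, rho (fo_l h x) = tmul2 (@fo_l _ G) *%R (copr h) (rho x),
      forall x h, rho (fo_r x h) = tmul2 (@fo_r _ G) *%R (rho x) (copr h) &
      forall h, rho (fo_d G h) = tmap (@fo_d _ G) id (copr h)].

Definition bicovariant (H : hopf k) (G : fodc H) : Prop :=
  exists (lam : {linear G -> H \otimes G}) (rho : {linear G -> G \otimes H}),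
    [/\ left_covariant lam, right_covariant rho &
        forall x, tassoc (tmap lam id (rho x)) = tmap id rho (lam x)].

Section MaximalProlongation.
Variables (H : algType k) (G : fodc H).

(* The word (h, [:: x1; ...; xn]) stands for h x1 (x)_H ... (x)_H xn in the
   tensor algebra of G over H, and talg_eq is equality in the tensor algebra of
   formal sums of words. *)
Definition tword : Type := (H * seq G)%type.

Inductive talg_rel : seq tword -> seq tword -> Prop :=
| TalgD h h' w : talg_rel [:: (h + h', w)] [:: (h, w); (h', w)]
| Talg0 w : talg_rel [:: (0, w)] [::]
| TalgSlot h u x y w :
    talg_rel [:: (h, u ++ (x + y) :: w)]
             [:: (h, u ++ x :: w); (h, u ++ y :: w)]
| TalgHead h g x w : talg_rel [:: (h * g, x :: w)] [:: (h, fo_l g x :: w)]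
| TalgBal h u x g y w :
    talg_rel [:: (h, u ++ fo_r x g :: y :: w)]
             [:: (h, u ++ x :: fo_l g y :: w)].

Definition talg_eq : seq tword -> seq tword -> Prop := fscong talg_rel.

(* The two-sided ideal of the tensor algebra generated by the elements
   sum_i d a_i (x)_H d b_i with sum_i a_i d b_i = 0. In ProlGen such an element
   is multiplied by (h, u) on the left and by (h', w) on the right. *)
Inductive prol_ideal : seq tword -> Prop :=
| ProlNil : prol_ideal [::]
| ProlGen h u (r : seq (H * H)) h' w :
    \sum_(p <- r) fo_l p.1 (fo_d G p.2) = 0 ->
    prol_ideal [seq (h, u ++ fo_d G p.1 :: fo_r (fo_d G p.2) h' :: w) | p <- r]
| ProlAdd s t : prol_ideal s -> prol_ideal t -> prol_ideal (s ++ t)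
| ProlEq s t : talg_eq s t -> prol_ideal s -> prol_ideal t.

Definition talg_eval (Om : calculus H) (i : G -> Om) (t : seq tword) : Om :=
  \sum_(p <- t) foldl (fun w x => w \w i x) (cal_in Om p.1) p.2.

(* Om is the quotient of the tensor algebra by the ideal: i is a map of first
   order calculi, and the kernel of the algebra morphism it induces on the
   tensor algebra, which is onto by cal_span, is the ideal. *)
Definition maximal_prolongation (Om : calculus H) : Prop :=
  exists i : {linear G -> Om},
    [/\ forall h x, i (fo_l h x) = cal_in Om h \w i x,
        forall x h, i (fo_r x h) = i x \w cal_in Om h,
        forall h, i (fo_d G h) = dga_d (cal_in Om h) &
        forall t, talg_eval i t = 0 <-> prol_ideal t].

End MaximalProlongation.

End FirstOrder.

Section Vertical.
Variables (k : fieldType) (H : hopf k) (OmH : calculus H).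

Definition extends_coproduct (D : OmH -> OmH \otimes OmH) : Prop :=
  @dga_morphism _ OmH (tensor_dga OmH OmH) D /\
  forall h, D (cal_in OmH h) = tmap (cal_in OmH) (cal_in OmH) (copr h).

Definition extends_coaction (A : comodAlg H) (OmA : calculus A)
    (D : OmA -> OmA \otimes OmH) : Prop :=
  @dga_morphism _ OmA (tensor_dga OmA OmH) D /\
  forall a, D (cal_in OmA a) = tmap (cal_in OmA) (cal_in OmH) (coact a).

(* The left H-coaction on the forms on H, which is determined by
   lam (h0 d h1 /\ ... /\ d hn)
     = (h0)_1 ... (hn)_1 (x) (h0)_2 d (h1)_2 /\ ... /\ d (hn)_2. *)
Definition left_coaction (lam : OmH -> H \otimes OmH) : Prop :=
  [/\ forall h, lam (cal_in OmH h) = tmap id (cal_in OmH) (copr h),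
      forall w e, lam (w \w e) = tmul2 *%R (@dga_mul k OmH) (lam w) (lam e) &
      forall w, lam (dga_d w) = tmap id (@dga_d k OmH) (lam w)].

Variable lam : {linear OmH -> H \otimes OmH}.

Definition linv : {pred OmH} := fun w => `[< lam w = 1 \ox w >].

Lemma linv_submod : GRing.submod_closed linv.
Proof.
split=> [|c w e /asboolP ew /asboolP ee]; apply/asboolP.
  rewrite linear0 -[X in _ \ox X](scale0r 0) tenspZr.
  by rewrite tenspZl scale0r.
by rewrite linearP /= ew ee tensp_linearr.
Qed.

HB.instance Definition _ := GRing.isSubmodClosed.Build k OmH linv linv_submod.

Record linvForm := LinvForm {linv_val : OmH; linv_valP : linv_val \in linv}.
HB.instance Definition _ := [isSub for linv_val].
HB.instance Definition _ := [Choice of linvForm by <:].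
HB.instance Definition _ := [SubChoice_isSubLmodule of linvForm by <:].

(* A left coinvariant form seen in linvForm; the default value 0 is never used
   below, since to_linv is applied to coinvariant forms only as soon as lam is
   a left coaction. *)
Definition to_linv (w : OmH) : linvForm := insubd 0 w.

Definition pi_inv (w : OmH) : linvForm :=
  to_linv (tlift (fun h e => cal_in OmH (antip h) \w e) (lam w)).

Definition linv_act (th : linvForm) (h : H) : linvForm :=
  to_linv (tlift (fun h1 h2 =>
    cal_in OmH (antip h1) \w val th \w cal_in OmH h2) (copr h)).

Definition pi_eps (h : H) : H := h - (counit h : k) *: 1.

Definition varpi (h : H) : linvForm :=
  to_linv (tlift (fun h1 h2 =>
    cal_in OmH (antip h1) \w dga_d (cal_in OmH h2)) (copr h)).

Definition linv_mul (th et : linvForm) : linvForm := to_linv (val th \w val et).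

Variable A : comodAlg H.

Definition ver : dgaOps k :=
  @DgaOps k (A \otimes linvForm)
    (1 \ox to_linv (dga_one OmH))
    (fun s t => tlift (fun a th => tlift (fun b et =>
        tlift (fun b0 b1 => (a * b0) \ox linv_mul (linv_act th b1) et)
              (coact b)) t) s)
    (fun n => tmap id (fun th => to_linv (dga_gr n (val th))))
    (tlift (fun a th => a \ox to_linv (dga_d (val th)) +
        tlift (fun a0 a1 => a0 \ox linv_mul (varpi (pi_eps a1)) th) (coact a))).

Variable OmA : calculus A.

(* The projection cal_pr on A = Om^0(A) plays the part of the identity: D
   preserves the degree, so that D w and the target of id (x) gr n meet in
   Om^0(A) (x) Om^n(H) when w is of degree n. *)
Definition ver_formula (D : OmA -> OmA \otimes OmH) (n : nat) (w : OmA) : ver :=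
  tmap (cal_pr OmA) (fun e => pi_inv (dga_gr n e)) (D w).

(* \sum F a_0 a_1 a_2 in Sweedler notation *)
Definition sweedler3 (W : zmodType) (a : A) (F : A -> H -> H -> W) : W :=
  tlift (fun t a2 => tlift (fun a0 a1 => F a0 a1 a2) t)
        (tmap (@coact k H A) id (coact a)).

Fixpoint ver_explicit_rec (s : seq A) (x : A) (h : H) (w : OmH) :
    A \otimes OmH :=
  if s is b :: s' then
    sweedler3 b (fun b0 b1 b2 =>
      ver_explicit_rec s' (x * b0) (h * b1) (w \w dga_d (cal_in OmH b2)))
  else x \ox (cal_in OmH (antip h) \w w).

(* a0_0 a1_0 ... an_0 (x) S(a0_1 a1_1 ... an_1) a0_2 d a1_2 /\ ... /\ d an_2,
   for s = [:: a1; ...; an] *)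
Definition ver_explicit (a0 : A) (s : seq A) : A \otimes OmH :=
  sweedler3 a0 (fun x h h' => ver_explicit_rec s x h (cal_in OmH h')).

End Vertical.

(* Main.v *)
Require Import Defs.
From mathcomp Require Import all_boot all_order all_algebra.
From mathcomp Require Import all_classical.
Import GRing.Theory.
Local Open Scope ring_scope.
Set Implicit Arguments.
Unset Strict Implicit.
Unset Printing Implicit Defensive.

(** Vertical forms are the elements of A (x) Omega(H) on which the coaction of
    A and the left coaction of Omega(H) agree. Concretely, the map [ver_emb]
    from A (x) Lambda to A (x) Omega(H) sends a (x) th to a_0 (x) a_1 th; it has
    the left inverse id (x) pi_inv ([ver_proj]) because pi_inv (h th) =
    eps(h) th for a coinvariant th. It untwists everything: the antipode
    cancels in a_1 b_1 S(b_2) th b_3 = a_1 th b_1, so that the product of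
    ver(A) becomes the componentwise product, and h_1 varpi(h_2) = d h turns
    the vertical differential into id (x) d ([ver_emb_morphism]). With these
    operations A (x) Omega(H) is visibly a differential graded algebra
    ([alg_forms_dga]), and the axioms pass to ver(A) along the injection.

    On the other side, discarding the forms of positive degree in the first
    factor of Omega(A) (x) Omega(H) is a morphism onto A (x) Omega(H)
    ([vert_part_morphism]): the Koszul signs are trivial on what is kept.
    After the extended coaction it gives a morphism [vert_coact] from Omega(A)
    to A (x) Omega(H), under which a goes to a_0 (x) a_1, the image of the
    vertical form a (x) 1. Since Omega(A) is generated by A and dA,
    [vert_coact] takes all its values in the image of [ver_emb], so that
    [vert_map], which is id (x) pi_inv after [vert_coact], satisfies
    ver_emb o vert_map = vert_coact ([emb_vert_map]). Injectivity of [ver_emb]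
    then makes it a morphism.

    It is onto by the Galois condition. Every 1 (x) h is a sum of
    p q_0 (x) q_1, hence 1 (x) h and 1 (x) dh are sums of (p (x) 1) F(q) and
    (p (x) 1) F(dq) with F = [vert_coact], and A (x) Omega(H) is spanned over A
    by the image of F ([left_span_all]). Applying the left A-linear map
    id (x) pi_inv to such an expression of a (x) th exhibits a (x) th as a
    value of [vert_map].

    The explicit formula is the evaluation of F on a form a0 da1 ... dan: it
    is the product of the a0_0 (x) a0_1 and the ai_0 (x) d ai_1, and the left
    coaction entering pi_inv splits each second factor once more
    ([eval_rec_cons]). *)

(** * Linear maps and Sweedler sums *)

Section Lin.
Variable k : fieldType.
Implicit Types U V W X : lmodType k.

(** The property is attached to bare functions between fixed modules, so that
    terms built from Sweedler sums can be shown linear by their syntax alone. *)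
Definition lin U V (f : U -> V) : Prop :=
  forall c u v, f (c *: u + v) = c *: f u + f v.

Definition bilin U V W (f : U -> V -> W) : Prop :=
  (forall v, lin (fun u => f u v)) /\ (forall u, lin (f u)).

Definition trilin U V W X (f : U -> V -> W -> X) : Prop :=
  [/\ forall v w, lin (fun u => f u v w), forall u w, lin (fun v => f u v w)
    & forall u v, lin (f u v)].

Lemma linD U V (f : U -> V) : lin f -> {morph f : u v / u + v}.
Proof. by move=> lf u v; rewrite -[u]scale1r lf !scale1r. Qed.

Lemma lin0 U V (f : U -> V) : lin f -> f 0 = 0.
Proof. by move=> lf; apply: (addIr (f 0)); rewrite -(linD lf) !add0r. Qed.

Lemma linZ U V (f : U -> V) : lin f -> forall c, {morph f : u / c *: u}.
Proof.
by move=> lf c u; rewrite -[in LHS](addr0 (c *: u)) lf (lin0 lf) addr0.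
Qed.

Lemma lin_sum U V (f : U -> V) : lin f -> forall I (r : seq I) (P : pred I) F,
  f (\sum_(i <- r | P i) F i) = \sum_(i <- r | P i) f (F i).
Proof. by move=> lf I r P F; apply: big_morph; [exact: linD | exact: lin0]. Qed.

Lemma lin_id U : lin (fun u : U => u). Proof. by []. Qed.

Lemma lin_cst0 U V : lin (fun _ : U => 0 : V).
Proof. by move=> c u v; rewrite scaler0 addr0. Qed.

Lemma lin_comp U V W (f : V -> W) (g : U -> V) :
  lin f -> lin g -> lin (fun u => f (g u)).
Proof. by move=> lf lg c u v; rewrite lg lf. Qed.

Lemma lin_linear U V (f : {linear U -> V}) : lin f.
Proof. by move=> c u v; rewrite linearP. Qed.

Lemma lin_add U V (f g : U -> V) :
  lin f -> lin g -> lin (fun u => f u + g u).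
Proof. by move=> lf lg c u v; rewrite lf lg scalerDr addrACA. Qed.

Lemma lin_scale U V (c : k) (f : U -> V) : lin f -> lin (fun u => c *: f u).
Proof. by move=> lf b u v; rewrite lf scalerDr !scalerA mulrC. Qed.

Lemma lin_sumf U V I (r : seq I) (P : pred I) (f : I -> U -> V) :
  (forall i, lin (f i)) -> lin (fun u => \sum_(i <- r | P i) f i u).
Proof.
move=> lf c u v; rewrite scaler_sumr -big_split /=.
by apply: eq_bigr => i _; rewrite lf.
Qed.

Lemma lin_bil1 U V W X (m : V -> W -> X) (g : U -> V) w :
  bilin m -> lin g -> lin (fun u => m (g u) w).
Proof. by move=> [lm _] lg c u v; rewrite lg lm. Qed.

Lemma lin_bil2 U V W X (m : W -> V -> X) (g : U -> V) w :
  bilin m -> lin g -> lin (fun u => m w (g u)).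
Proof. by move=> [_ lm] lg c u v; rewrite lg lm. Qed.

Lemma bilin_tensp U V : bilin (@tensp k U V).
Proof.
by split=> [v c u u'|u c v v']; rewrite ?tenspDl ?tenspDr ?tenspZr ?tenspZl.
Qed.

Lemma bilin_mul (A : algType k) : bilin (fun x y : A => x * y).
Proof.
by split=> z c x y; rewrite ?mulrDl ?mulrDr -?scalerAl -?scalerAr.
Qed.

Lemma bilin_scale V : bilin (fun (c : k^o) (v : V) => (c : k) *: v).
Proof.
split=> [v c a b|a c u v]; first by rewrite scalerDl -scalerA.
by rewrite scalerDr !scalerA mulrC.
Qed.

End Lin.

(** Sweedler notation when t is a coproduct or a coaction: f u v summed over
    t = sum u (x) v. Requiring all types to be modules over k gives every such
    sum one canonical form. *)
Definition sweedler (k : fieldType) (U V W : lmodType k) (f : U -> V -> W)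
  (t : U \otimes V) : W := tlift f t.

Notation "\sw_ ( x , y <- t ) E" := (sweedler (fun x y => E) t)
  (at level 41, x binder, y binder, t at level 200, E at level 41).

Section SweedlerSums.
Variable k : fieldType.
Implicit Types U V W X : lmodType k.

Section Sweedler.
Variables (U V : lmodType k).

Lemma tensor_ind (P : U \otimes V -> Prop) : P 0 ->
  (forall s t, P s -> P t -> P (s + t)) -> (forall u v, P (u \ox v)) ->
  forall t, P t.
Proof.
move=> P0 PD Pp t; have [s ->] := tens_span t.
elim: s => [|p s IHs]; rewrite ?big_nil // big_cons.
by apply: PD => //; apply: Pp.
Qed.

Lemma sw_tensp W (f : U -> V -> W) u v :
  bilin f -> sweedler f (u \ox v) = f u v.
Proof.
case=> l1 l2; apply: tlift_pure => [u1 u2 v1|u1 v1 v2|u1 c v1].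
- exact: (linD (l1 v1)).
- exact: linD.
- by rewrite (linZ (l1 _)) (linZ (l2 _)).
Qed.

Lemma lin_sweedler W (f : U -> V -> W) : bilin f -> lin (sweedler f).
Proof.
move=> bf; have [l1 l2] := bf.
have tD : {morph sweedler f : s t / s + t}.
  apply: tliftD => [u1 u2 v1|u1 v1 v2|u1 c v1].
  - exact: (linD (l1 v1)).
  - exact: linD.
  - by rewrite (linZ (l1 _)) (linZ (l2 _)).
have t0 : sweedler f 0 = 0.
  by apply: (addIr (sweedler f 0)); rewrite -tD !add0r.
move=> c s t; rewrite tD; congr (_ + _).
elim/tensor_ind: s => [|s1 s2 e1 e2|u v].
- by rewrite scaler0 t0 scaler0.
- by rewrite scalerDr !tD scalerDr e1 e2.
- by rewrite -tenspZl !sw_tensp // (linZ (l1 _)).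
Qed.

Lemma sw_eq W (f g : U -> V -> W) (t : U \otimes V) :
  (forall u v, f u v = g u v) -> sweedler f t = sweedler g t.
Proof. by move=> e; apply: eq_bigr. Qed.

Lemma lin_swf X W (f : X -> U -> V -> W) (t : U \otimes V) :
  (forall u v, lin (fun x => f x u v)) -> lin (fun x => sweedler (f x) t).
Proof. by move=> lf; apply: lin_sumf => p; apply: lf. Qed.

Lemma sw_push W X (L : W -> X) (f : U -> V -> W) (t : U \otimes V) :
  lin L -> L (sweedler f t) = \sw_(u, v <- t) L (f u v).
Proof. by move=> lL; apply: lin_sum. Qed.

(** Both sides are finite sums over the chosen representatives of s and t,
    so that no linearity is involved; the same holds for [sw_eq] and
    [sw_push]. *)
Lemma sw_exch (U' V' : lmodType k) W (f : U -> V -> U' -> V' -> W)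
  (s : U \otimes V) (t : U' \otimes V') :
  \sw_(u, v <- s) sweedler (f u v) t =
  \sw_(u', v' <- t) \sw_(u, v <- s) f u v u' v'.
Proof. exact: exchange_big. Qed.

Lemma sw_id (t : U \otimes V) : \sw_(u, v <- t) (u \ox v) = t.
Proof. by rewrite -[RHS]reprK tens_pi_sum. Qed.

Lemma sw_0 W (f : U -> V -> W) (t : U \otimes V) :
  (forall u v, f u v = 0) -> sweedler f t = 0.
Proof. by move=> e; apply: big1. Qed.

Lemma sw_add W (f g : U -> V -> W) (t : U \otimes V) :
  \sw_(u, v <- t) (f u v + g u v) = sweedler f t + sweedler g t.
Proof. exact: big_split. Qed.

Lemma tensor_ext W (f g : U \otimes V -> W) : lin f -> lin g ->
  (forall u v, f (u \ox v) = g (u \ox v)) -> f =1 g.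
Proof.
move=> lf lg e; elim/tensor_ind => [|s t es et|u v]; last exact: e.
  by rewrite !lin0.
by rewrite !linD // es et.
Qed.

End Sweedler.

Lemma sw_sw U V U' V' W (f : U' -> V' -> W) (g : U -> V -> U' \otimes V')
  (t : U \otimes V) : bilin f ->
  sweedler f (sweedler g t) = \sw_(u, v <- t) sweedler f (g u v).
Proof. by move=> bf; apply: sw_push; apply: lin_sweedler. Qed.

Section Maps.
Variables (U V U' V' : lmodType k).

Lemma tmapE (g : U -> U') (h : V -> V') (t : U \otimes V) :
  tmap g h t = \sw_(u, v <- t) (g u \ox h v).
Proof. by []. Qed.

Lemma tmul2E U'' V'' (m : U -> U' -> U'') (n : V -> V' -> V'') s t :
  tmul2 m n s t = \sw_(u, v <- s) \sw_(u', v' <- t) (m u u' \ox n v v').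
Proof. by []. Qed.

Lemma tassocE W (t : (U \otimes V) \otimes W) :
  tassoc t = \sw_(s, w <- t) \sw_(u, v <- s) (u \ox (v \ox w)).
Proof. by []. Qed.

Lemma sw_tmap W (f : U' -> V' -> W) (g : U -> U') (h : V -> V')
  (t : U \otimes V) :
  bilin f -> sweedler f (tmap g h t) = \sw_(u, v <- t) f (g u) (h v).
Proof.
move=> bf; rewrite tmapE sw_sw //.
by apply: sw_eq => u v; rewrite sw_tensp.
Qed.

Lemma sw_tmul2 U'' V'' W (f : U'' -> V'' -> W) (m : U -> U' -> U'')
  (n : V -> V' -> V'')
  (s : U \otimes V) (t : U' \otimes V') : bilin f ->
  sweedler f (tmul2 m n s t) =
  \sw_(u, v <- s) \sw_(u', v' <- t) f (m u u') (n v v').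
Proof.
move=> bf; rewrite tmul2E sw_sw //; apply: sw_eq => u v.
by rewrite sw_sw //; apply: sw_eq => u' v'; rewrite sw_tensp.
Qed.

End Maps.

Lemma sw_tassoc U V W X (f : U -> V -> W -> X) (t : (U \otimes V) \otimes W) :
  trilin f ->
  \sw_(u, s <- tassoc t) sweedler (f u) s =
  \sw_(s, w <- t) \sw_(u, v <- s) f u v w.
Proof.
case=> l1 l2 l3.
have b1 u : bilin (f u) by split=> ?; [exact: l2 | exact: l3].
have b : bilin (fun u (s : V \otimes W) => sweedler (f u) s).
  split=> [s|u]; last exact: lin_sweedler.
  by apply: lin_swf => v w; apply: l1.
rewrite tassocE sw_sw //; apply: sw_eq => s w.
by rewrite sw_sw //; apply: sw_eq => u v; rewrite !sw_tensp.
Qed.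

End SweedlerSums.

Lemma lin_mapf (k : fieldType) (U U' V V' : lmodType k)
  (f : U -> U') (g : V -> V') :
  lin f -> lin g -> lin (tmap f g).
Proof.
move=> lf lg; apply: lin_sweedler; split=> [v|u].
  by apply: lin_bil1 => //; apply: bilin_tensp.
by apply: lin_bil2 => //; apply: bilin_tensp.
Qed.

Lemma bilin_wedge (k : fieldType) (D : dga k) : bilin (@dga_mul k D).
Proof.
split=> [y c u v|x c u v].
  exact: (dga_mul_linl (dga_ax D) y c u v).
exact: (dga_mul_linr (dga_ax D) x c u v).
Qed.

Lemma lin_d (k : fieldType) (D : dga k) : lin (@dga_d k D).
Proof. exact: (dga_d_lin (dga_ax D)). Qed.

Lemma lin_gr (k : fieldType) (D : dga k) n : lin (@dga_gr k D n).
Proof. exact: (dga_gr_lin (dga_ax D) n). Qed.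

Lemma lin_mul1 (k : fieldType) (U : lmodType k) (A : algType k) (f : U -> A) a :
  lin f -> lin (fun u => f u * a).
Proof. by move=> lf; exact: lin_bil1 (bilin_mul _) lf. Qed.

Lemma lin_mul2 (k : fieldType) (U : lmodType k) (A : algType k) (f : U -> A) a :
  lin f -> lin (fun u => a * f u).
Proof. by move=> lf; exact: lin_bil2 (bilin_mul _) lf. Qed.

Lemma lin_ox1 (k : fieldType) (U V W : lmodType k) (f : U -> V) (w : W) :
  lin f -> lin (fun u => f u \ox w).
Proof. by move=> lf; exact: lin_bil1 (bilin_tensp _ _) lf. Qed.

Lemma lin_ox2 (k : fieldType) (U V W : lmodType k) (f : U -> V) (w : W) :
  lin f -> lin (fun u => w \ox f u).
Proof. by move=> lf; exact: lin_bil2 (bilin_tensp _ _) lf. Qed.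

Lemma lin_wedge1 (k : fieldType) (U : lmodType k) (D : dga k) (f : U -> D) a :
  lin f -> lin (fun u => f u \w a).
Proof. by move=> lf; exact: lin_bil1 (bilin_wedge _) lf. Qed.

Lemma lin_wedge2 (k : fieldType) (U : lmodType k) (D : dga k) (f : U -> D) a :
  lin f -> lin (fun u => a \w f u).
Proof. by move=> lf; exact: lin_bil2 (bilin_wedge _) lf. Qed.

Lemma lin_scalel (k : fieldType) (U V : lmodType k) (f : U -> k^o) (v : V) :
  lin f -> lin (fun u => (f u : k) *: v).
Proof. by move=> lf; exact: lin_bil1 (bilin_scale _) lf. Qed.

Lemma lin_tmul1 (k : fieldType) (U V U' V' U'' V'' X : lmodType k)
  (m : U -> U' -> U'') (n : V -> V' -> V'') (f : X -> U \otimes V) t :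
  bilin m -> bilin n -> lin f -> lin (fun x => tmul2 m n (f x) t).
Proof.
move=> bm bn; have b : bilin (fun u v => \sw_(u', v' <- t) (m u u' \ox n v v')).
  by split=> ?; apply: lin_swf => u' v';
    [exact: (lin_ox1 _ (bm.1 _)) | exact: (lin_ox2 _ (bn.1 _))].
exact: lin_comp (lin_sweedler b).
Qed.

Lemma lin_tmul2 (k : fieldType) (U V U' V' U'' V'' X : lmodType k)
  (m : U -> U' -> U'') (n : V -> V' -> V'') (f : X -> U' \otimes V')
  (t : U \otimes V) :
  bilin m -> bilin n -> lin f -> lin (fun x => tmul2 m n t (f x)).
Proof.
move=> bm bn lf; have b u v : bilin (fun u' v' => m u u' \ox n v v').
  by split=> ?; [exact: (lin_ox1 _ (bm.2 _)) | exact: (lin_ox2 _ (bn.2 _))].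
pose F x u v := \sw_(u', v' <- f x) (m u u' \ox n v v').
have lF u v : lin (fun x => F x u v).
  exact: lin_comp (lin_sweedler (b u v)) lf.
exact: (lin_swf (f := F) t lF).
Qed.

Section Trilin.
Variables (k : fieldType) (U V W X : lmodType k) (f : U -> V -> W -> X).
Hypothesis tf : trilin f.

Lemma trilin1 v w : lin (fun u => f u v w). Proof. by case: tf. Qed.

Lemma trilin2 u w : lin (fun v => f u v w). Proof. by case: tf. Qed.

Lemma trilin3 u v : lin (fun w => f u v w). Proof. by case: tf. Qed.

End Trilin.

(** Proves linearity in one variable, and hence bilinearity and trilinearity,
    by descending through the head symbol of a term. In each binary case the
    two lemmas are tried in turn: the one whose fixed argument would depend on
    the variable fails to unify. *)
Ltac linearity :=
  intros; cbv beta;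
  lazymatch goal with
  | |- bilin (@GRing.mul _) => exact: bilin_mul
  | |- bilin (@dga_mul _ _) => exact: bilin_wedge
  | |- bilin (@tensp _ _ _) => exact: bilin_tensp
  | |- bilin _ => first [assumption | split; linearity]
  | |- trilin _ => first [assumption | split; linearity]
  | |- lin (fun x => x) => exact: lin_id
  | |- lin (fun x => 0) => exact: lin_cst0
  | |- lin (@dga_mul _ _ _) => apply: lin_wedge2; exact: lin_id
  | |- lin (@GRing.mul _ _) => apply: lin_mul2; exact: lin_id
  | |- lin (@tensp _ _ _ _) => apply: lin_ox2; exact: lin_id
  | |- lin (@GRing.scale _ _ _) => apply: lin_scale; exact: lin_id
  | |- lin (tmul2 _ _ _) => apply: lin_tmul2;
    [linearity | linearity | exact: lin_id]
  | |- lin (fun x => _ + _) => apply: lin_add; linearity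
  | |- lin (fun x => _ \ox _) => first [apply: lin_ox1 | apply: lin_ox2];
    linearity
  | |- lin (fun x => _ * _) => first [apply: lin_mul1 | apply: lin_mul2];
    linearity
  | |- lin (fun x => _ \w _) => first [apply: lin_wedge1 | apply: lin_wedge2];
    linearity
  | |- lin (fun x => tmul2 _ _ _ _) =>
      first [apply: lin_tmul1 | apply: lin_tmul2]; linearity
  | |- lin (fun x => _ *: _) => first [apply: lin_scale | apply: lin_scalel];
    linearity
  | |- lin (sweedler _) => apply: lin_sweedler; linearity
  | |- lin (fun x => sweedler _ _) =>
     first [apply: lin_swf; linearity | apply: lin_comp; [apply: lin_sweedler;
       linearity | linearity]]
  | |- lin (@dga_d _ _) => exact: lin_d
  | |- lin (fun x => dga_d _) => apply: lin_comp; [exact: lin_d | linearity]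
  | |- lin (dga_gr _) => exact: lin_gr
  | |- lin (fun x => dga_gr _ _) => apply: lin_comp; [exact: lin_gr | linearity]
  | |- lin (tmap _ _) => apply: lin_mapf; linearity
  | |- lin (fun x => tmap _ _ _) => apply: lin_comp; [apply: lin_mapf;
    linearity | linearity]
  | |- lin (@GRing.Linear.sort _ _ _ _ _) => exact: lin_linear
  | |- lin (fun x => @GRing.Linear.sort _ _ _ _ _ _) =>
      apply: lin_comp; [exact: lin_linear | linearity]
  | |- _ => first [ assumption | exact: lin_id
    | match goal with b : bilin _ |- _ =>
        solve [apply: b.1 | apply: b.2
             | apply: (lin_bil1 _ b); linearity | apply: (lin_bil2 _ b);
               linearity] end
    | match goal with b : trilin _ |- _ =>
        solve [apply: (trilin1 b) | apply: (trilin2 b) | apply: (trilin3 b)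
             | apply: (lin_comp (trilin1 b _ _)); linearity
             | apply: (lin_comp (trilin2 b _ _)); linearity
             | apply: (lin_comp (trilin3 b _ _)); linearity] end
    | match goal with b : lin _ |- _ => solve [apply: (lin_comp b);
      linearity] end
    | idtac ]
  end.

Lemma bilin_tmul2 (k : fieldType) (U V U' V' U'' V'' : lmodType k)
  (m : U -> U' -> U'') (n : V -> V' -> V'') :
  bilin m -> bilin n -> bilin (tmul2 m n).
Proof.
move=> bm bn; split=> ?.
  exact: (lin_tmul1 _ bm bn (@lin_id _ _)).
exact: (lin_tmul2 _ bm bn (@lin_id _ _)).
Qed.

Lemma tmul2_pure (k : fieldType) (U V U' V' U'' V'' : lmodType k)
  (m : U -> U' -> U'') (n : V -> V' -> V'') u v u' v' :
  bilin m -> bilin n -> tmul2 m n (u \ox v) (u' \ox v') = m u u' \ox n v v'.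
Proof. by move=> bm bn; rewrite tmul2E !sw_tensp //; linearity. Qed.

Lemma tmap_pure (k : fieldType) (U V U' V' : lmodType k)
  (f : U -> U') (g : V -> V') u v :
  lin f -> lin g -> tmap f g (u \ox v) = f u \ox g v.
Proof. by move=> lf lg; rewrite tmapE sw_tensp //; linearity. Qed.

Lemma tmul2A (k : fieldType) (U V : lmodType k)
  (m : U -> U -> U) (n : V -> V -> V) : bilin m -> bilin n ->
  associative m -> associative n -> associative (tmul2 m n).
Proof.
move=> bm bn mA nA x y z; have bM := bilin_tmul2 bm bn.
move: x; apply: tensor_ext; [by linearity|by linearity|] => a w.
move: y; apply: tensor_ext; [by linearity|by linearity|] => b e.
move: z; apply: tensor_ext; [by linearity|by linearity|] => c f.
by rewrite !tmul2_pure // mA nA.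
Qed.

(** * Homogeneous components and generation of calculi *)

Section DgaFacts.
Variables (k : fieldType) (D : dga k).
Implicit Types x y : D.

Lemma gr_gr m n x : dga_gr m (dga_gr n x) = if m == n then dga_gr n x else 0.
Proof. exact: (dga_gr_idem (dga_ax D)). Qed.

Lemma homog_gr n x : homog n (dga_gr n x).
Proof. by rewrite /homog gr_gr eqxx. Qed.

Lemma gr_homog m n x : homog n x -> dga_gr m x = if m == n then x else 0.
Proof. by move=> hx; rewrite -hx gr_gr; case: eqP => // ->. Qed.

Lemma gr_vanish x : exists N, forall n, (N <= n)%N -> dga_gr n x = 0.
Proof.
have [N e] := dga_gr_sum (dga_ax D) x; exists N => n Nn.
rewrite e (lin_sum (@lin_gr k D n)) big1 // => i _.
by rewrite gr_gr gtn_eqF // (leq_trans (ltn_ord i)).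
Qed.

Lemma gr_sumN x : exists N, forall M, (N <= M)%N -> x = \sum_(i < M) dga_gr i x.
Proof.
have [N e] := dga_gr_sum (dga_ax D) x; have [P v] := gr_vanish x.
exists (maxn N P) => M; rewrite geq_max => /andP[NM PM].
rewrite [LHS]e (big_ord_widen M (fun i => dga_gr i x) NM).
rewrite [RHS](bigID (fun i : 'I_M => (i < N)%N)) /= [X in _ + X]big1 ?addr0 //.
move=> i; rewrite -leqNgt => Ni.
rewrite [in LHS]e (lin_sum (@lin_gr k D i)) big1 // => j _.
by rewrite gr_gr gtn_eqF // (leq_trans (ltn_ord j)).
Qed.

Lemma homogM m n x y : homog m x -> homog n y -> homog (m + n)%N (x \w y).
Proof. exact: (dga_mul_homog (dga_ax D)). Qed.

Lemma gr_wedge_homog m n x y :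
  homog m x -> dga_gr (m + n) (x \w y) = x \w dga_gr n y.
Proof.
move=> hx; have [N e] := dga_gr_sum (dga_ax D) y.
have lw : lin (fun y => x \w y) by linearity.
rewrite [in LHS]e [in RHS]e (lin_sum lw) !(lin_sum (@lin_gr k D _)).
rewrite (lin_sum lw).
apply: eq_bigr => i _; rewrite (gr_homog _ (homogM hx (homog_gr i y))) gr_gr.
by rewrite eqn_add2l; case: eqP => // _; rewrite (lin0 lw).
Qed.

Lemma wedge_gr n (w e : D) : homog 1 e ->
  dga_gr n (w \w e) = if n is m.+1 then dga_gr m w \w e else 0.
Proof.
move=> he; have [N ew] := dga_gr_sum (dga_ax D) w.
have lw : lin (fun w => w \w e) by linearity.
have E i : dga_gr n (dga_gr i w \w e) =
    if n is m.+1 then dga_gr m (dga_gr i w) \w e else 0.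
  rewrite (gr_homog _ (homogM (homog_gr i w) he)) addn1.
  by case: n => [|n]; rewrite // eqSS gr_gr; case: eqP => // _;
    rewrite (lin0 lw).
rewrite [in LHS]ew [in RHS]ew (lin_sum lw) (lin_sum (@lin_gr k D n)).
transitivity (\sum_(i < N) if n is m.+1 then dga_gr m (dga_gr i w) \w e else 0).
  by apply: eq_bigr => i _.
case: n {E} => [|n]; first by rewrite big1.
by rewrite [in RHS](lin_sum (@lin_gr k D n)) (lin_sum lw).
Qed.

(** A product of homogeneous elements has degree 0 only if both factors do, so
    the projection on degree 0 is multiplicative. *)
Lemma gr0_wedge x y : dga_gr 0 (x \w y) = dga_gr 0 x \w dga_gr 0 y.
Proof.
have [N /(_ N.+1 (leqnSn N)) e] := gr_sumN x.
have lw : lin (fun x => x \w y) by linearity.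
rewrite [in LHS]e (lin_sum lw) (lin_sum (@lin_gr k D 0)) big_ord_recl /=.
rewrite (@gr_wedge_homog 0 0) ?big1 ?addr0 //; last exact: homog_gr.
move=> i _; have [M e'] := dga_gr_sum (dga_ax D) y.
have lw' z : lin (fun y => z \w y) by linearity.
rewrite e' (lin_sum (lw' _)) (lin_sum (@lin_gr k D 0)) big1 // => j _.
by rewrite (gr_homog _ (homogM (homog_gr _ _) (homog_gr _ _))).
Qed.

Lemma gr0_d x : dga_gr 0 (dga_d x) = 0.
Proof.
have [N e] := dga_gr_sum (dga_ax D) x.
rewrite e (lin_sum (@lin_d k D)) (lin_sum (@lin_gr k D 0)) big1 // => i _.
by rewrite (gr_homog _ (dga_d_homog (dga_ax D) (homog_gr i x))).
Qed.

Lemma d_one : dga_d (dga_one D) = 0.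
Proof.
have ax := dga_ax D; have := dga_leibniz ax (dga_one D) (dga_one_homog ax).
rewrite (dga_mul1l ax) (dga_mul1l ax) (dga_mul1r ax) expr0 scale1r.
by move=> e; apply: (addIr (dga_d (dga_one D))); rewrite add0r -e.
Qed.

End DgaFacts.

Section Calculus.
Variables (k : fieldType) (A : algType k) (Om : calculus A).

(** Every form is a sum of iterated products a0 da1 ... dan, so a property of
    forms that is stable under sums need only be followed along right
    multiplication by differentials of elements of A. *)
Lemma calculus_ind (P : Om -> Prop) : P 0 ->
  (forall x y, P x -> P y -> P (x + y)) ->
  (forall a, P (cal_in Om a)) ->
  (forall x a, P x -> P (x \w dga_d (cal_in Om a))) -> forall w, P w.
Proof.
move=> P0 PD Pin Pd w; have [N ->] := dga_gr_sum (dga_ax Om) w.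
apply: big_rec => // i x _ Px; apply: (PD _ _ _ Px).
have [r ->] := cal_span (homog_gr i w).
apply: big_rec => // -[a s] y _ Py; apply: (PD _ _ _ Py); rewrite /dform /=.
elim: (tval s) (cal_in Om a) (Pin a) => //= b t IHt x' Px'.
by apply: IHt; apply: Pd.
Qed.

Lemma cal_in_inj : injective (cal_in Om).
Proof. by move=> a b e; rewrite -[a](cal_inK Om) e cal_inK. Qed.

Lemma cal_in_homog a : homog 0 (cal_in Om a).
Proof. by rewrite /homog -cal_prK cal_inK. Qed.

Lemma homog_d_in a : homog 1 (dga_d (cal_in Om a)).
Proof. exact: (dga_d_homog (dga_ax Om) (cal_in_homog a)). Qed.

Lemma cal_pr_gr n w :
  cal_pr Om (dga_gr n w) = if n == 0%N then cal_pr Om w else 0.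
Proof.
apply: cal_in_inj; rewrite cal_prK gr_gr eq_sym.
by case: eqP => [->|_]; rewrite ?cal_prK // linear0.
Qed.

Lemma cal_pr_wedge x y : cal_pr Om (x \w y) = cal_pr Om x * cal_pr Om y.
Proof. by apply: cal_in_inj; rewrite cal_inM !cal_prK gr0_wedge. Qed.

Lemma cal_pr_d x : cal_pr Om (dga_d x) = 0.
Proof. by apply: cal_in_inj; rewrite cal_prK gr0_d linear0. Qed.

Lemma cal_pr1 : cal_pr Om (dga_one Om) = 1.
Proof. by rewrite -cal_in1 cal_inK. Qed.

End Calculus.

(** * Forms on H with coefficients in A *)

Section Transfer.
Variables (k : fieldType) (V E : dgaOps k) (phi : V -> E).
Hypotheses (axE : is_dga E) (phi_inj : injective phi).
Hypothesis phi_m : dga_morphism phi.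

Lemma is_dga_transfer : is_dga V.
Proof.
have [lp p1 pM pgr pd] := phi_m; have lphi : lin phi by move=> c x y; apply: lp.
have [ml mr mA m1l m1r gl gi gs oh mh dl dh dd lb] := axE.
have homE n x : homog n x -> homog n (phi x) by rewrite /homog -pgr => ->.
split.
- move=> y c u v; apply: phi_inj; rewrite lp !pM lp; exact: ml.
- move=> y c u v; apply: phi_inj; rewrite lp !pM lp; exact: mr.
- by move=> x y z; apply: phi_inj; rewrite !pM mA.
- by move=> x; apply: phi_inj; rewrite pM p1 m1l.
- by move=> x; apply: phi_inj; rewrite pM p1 m1r.
- move=> n c u v; apply: phi_inj; rewrite lp !pgr lp; exact: gl.
- move=> m n x; apply: phi_inj; rewrite !pgr gi.
  by case: eqP => _; rewrite ?pgr ?(lin0 lphi).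
- move=> x; have [N e] := gs (phi x); exists N; apply: phi_inj.
  by rewrite (lin_sum lphi) e; apply: eq_bigr => i _; rewrite pgr.
- by rewrite /homog; apply: phi_inj; rewrite pgr p1.
- move=> m n x y hx hy; apply: phi_inj; rewrite pgr pM.
  exact: mh (homE _ _ hx) (homE _ _ hy).
- move=> c u v; apply: phi_inj; rewrite lp !pd lp; exact: dl.
- move=> n x hx; apply: phi_inj; rewrite pgr pd; exact: dh (homE _ _ hx).
- by move=> x; apply: phi_inj; rewrite !pd dd (lin0 lphi).
- move=> n x y hx; apply: phi_inj.
  by rewrite (linD lphi) (linZ lphi) !(pd, pM) (lb n) //; apply: homE.
Qed.

End Transfer.

Section AlgForms.
Variables (k : fieldType) (A : algType k) (D : dga k).

(** A (x) D where A sits in degree 0 and has zero differential; there are then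
    no Koszul signs. *)
Definition alg_forms : dgaOps k :=
  @DgaOps k (A \otimes D) (1 \ox dga_one D) (tmul2 *%R (@dga_mul k D))
    (fun n => tmap id (@dga_gr k D n)) (tmap id (@dga_d k D)).

Lemma alg_forms_dga : is_dga alg_forms.
Proof.
have ax := dga_ax D.
have bM := bilin_tmul2 (bilin_mul A) (bilin_wedge D).
have lgr n : lin (tmap (@id A) (@dga_gr k D n)).
  by apply: lin_mapf; [exact: lin_id | exact: lin_gr].
have ld : lin (tmap (@id A) (@dga_d k D)).
  by apply: lin_mapf; [exact: lin_id | exact: lin_d].
have eM (a b : A) (w e : D) : tmul2 *%R (@dga_mul k D) (a \ox w) (b \ox e) =
    (a * b) \ox (w \w e) by rewrite tmul2_pure //; linearity.
have egr n (a : A) (w : D) :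
    tmap id (@dga_gr k D n) (a \ox w) = a \ox dga_gr n w.
  by rewrite tmap_pure //; linearity.
have ed (a : A) (w : D) : tmap id (@dga_d k D) (a \ox w) = a \ox dga_d w.
  by rewrite tmap_pure //; linearity.
have ox0 (a : A) : a \ox (0 : D) = 0 by apply: (lin0 ((bilin_tensp A D).2 a)).
split=> /=.
- exact: bM.1.
- exact: bM.2.
- move=> x y z; move: x; apply: tensor_ext; [by linearity|by linearity|] => a w.
  move: y; apply: tensor_ext; [by linearity|by linearity|] => b e.
  move: z; apply: tensor_ext; [by linearity|by linearity|] => c f.
  by rewrite !eM mulrA (dga_mulA ax).
- apply: tensor_ext; [by linearity|by linearity|] => a w.
  by rewrite eM mul1r (dga_mul1l ax).
- apply: tensor_ext; [by linearity|by linearity|] => a w.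
  by rewrite eM mulr1 (dga_mul1r ax).
- exact: lgr.
- move=> m n; apply: tensor_ext.
  + by linearity.
  + by case: eqP => _; linearity.
  move=> a w.
  by rewrite !egr gr_gr; case: eqP.
- move=> x.
  suff [N e] : exists N, forall M, (N <= M)%N ->
      x = \sum_(i < M) tmap id (@dga_gr k D i) x by exists N; apply: e.
  elim/tensor_ind: x => [|x y [N ex] [P ey]|a w].
  + by exists 0%N => M _; rewrite big1 // => i _; rewrite (lin0 (lgr _)).
  + exists (maxn N P) => M; rewrite geq_max => /andP[NM PM].
    rewrite [LHS](congr2 _ (ex _ NM) (ey _ PM)) -big_split.
    by apply: eq_bigr => i _; rewrite (linD (lgr _)).
  + have [N e] := gr_sumN w; exists N => M NM.
    rewrite [in LHS](e _ NM) (lin_sum ((bilin_tensp A D).2 a)).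
    by apply: eq_bigr => i _; rewrite egr.
- by rewrite /homog /= egr (dga_one_homog ax).
- rewrite /homog /= => m n x y <- <-; move: x.
  apply: tensor_ext; [by linearity|by linearity|] => a w; move: y.
  apply: tensor_ext; [by linearity|by linearity|] => b e.
  by rewrite !egr eM egr (dga_mul_homog ax) //; apply: homog_gr.
- exact: ld.
- rewrite /homog /= => n x <-; move: x.
  apply: tensor_ext; [by linearity|by linearity|] => a w.
  by rewrite egr ed egr (dga_d_homog ax) //; apply: homog_gr.
- apply: (@tensor_ext _ _ _ _ _ (fun=> 0));
  [by linearity|exact: lin_cst0|] => a w.
  by rewrite !ed (dga_dd ax) ox0.
- rewrite /homog /= => n x y <-; move: x.
  apply: tensor_ext; [by linearity|by linearity|] => a w; move: y.
  apply: tensor_ext; [by linearity|by linearity|] => b e.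
  rewrite egr eM !ed !eM (dga_leibniz ax _ (homog_gr n w)) tenspDr.
  by rewrite tenspZr tenspZl.
Qed.

End AlgForms.

(** The sums over all degrees in a tensor product of differential graded
    algebras are evaluated by truncation. *)
Lemma fs_sumN (V : zmodType) (N : nat) (F : nat -> V) :
  (forall p, (N <= p)%N -> F p = 0) ->
  \sum_(p \in [set: nat]) F p = \sum_(p < N) F p.
Proof.
move=> F0; rewrite fsbig_ord; apply/esym/fsbig_widen => // p [_ /=] /negP.
by rewrite -leqNgt => /F0.
Qed.

Section Vertical.
Variables (k : fieldType) (A : algType k) (OmA : calculus A) (D : dga k).

(** The projection of Omega(A) onto its degree 0 component A, applied to the
    first factor. *)
Definition vert_part : OmA \otimes D -> A \otimes D := tmap (cal_pr OmA) id.

Lemma lin_vert_part : lin vert_part.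
Proof. by rewrite /vert_part; linearity. Qed.

Lemma vert_part_pure w e : vert_part (w \ox e) = cal_pr OmA w \ox e.
Proof. by rewrite /vert_part tmap_pure //; linearity. Qed.

(** The projection of Omega(A) on A is multiplicative and kills every dw. In the
    product of w (x) e and w' (x) e' only the degree 0 component of w' survives,
    and in the differential only the degree 0 component of w; in both cases the
    exponent of the sign is 0. *)
Lemma vert_part_morphism :
  @dga_morphism k (tensor_dga OmA D) (alg_forms A D) vert_part.
Proof.
have lv := lin_vert_part; split.
- by move=> c x y; apply: lv.
- by rewrite [LHS]vert_part_pure cal_pr1.
- move=> s t; rewrite [LHS](sw_push _ _ lv) /= /vert_part !tmapE tmul2E.
  rewrite sw_sw; last by linearity.
  apply: sw_eq => w e; rewrite sw_tensp; last by linearity.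
  rewrite sw_sw; last by linearity.
  rewrite [LHS](sw_push _ _ lv); apply: sw_eq => w' e'.
  rewrite sw_tensp; last by linearity.
  (* The bounds are taken so large that the truncated sums contain all nonzero
     components of e and w', and at least the component of degree 0 of w'. *)
  have [N1 vw] := gr_vanish w'; have [N2 ve] := gr_vanish e.
  have [N3 se] := gr_sumN e; set N := maxn N2 N3.
  have sw p : \sum_(q \in [set: nat])
      (-1) ^+ (p * q) *: ((w \w dga_gr q w') \ox (dga_gr p e \w e')) =
    \sum_(q < N1.+1)
      (-1) ^+ (p * q) *: ((w \w dga_gr q w') \ox (dga_gr p e \w e')).
    apply: fs_sumN => q /ltnW /vw ->.
    by rewrite (lin0 ((bilin_wedge OmA).2 w)) (lin0 ((bilin_tensp _ _).1 _))
      scaler0.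
  rewrite (@fs_sumN _ N) => [|p Np]; last first.
    rewrite sw big1 // => q _; rewrite ve ?(leq_trans (leq_maxl _ _) Np) //.
    by rewrite (lin0 ((bilin_wedge D).1 e')) (lin0 ((bilin_tensp _ _).2 _))
      scaler0.
  transitivity (\sum_(p < N)
      (cal_pr OmA w * cal_pr OmA w') \ox (dga_gr p e \w e')).
    rewrite (lin_sum lv); apply: eq_bigr => p _;
      rewrite sw (lin_sum lv) big_ord_recl.
    rewrite big1 ?addr0 => [|q _];
      rewrite (linZ lv) vert_part_pure cal_pr_wedge cal_pr_gr /=.
      by rewrite muln0 expr0 scale1r.
    by rewrite mulr0 (lin0 ((bilin_tensp _ _).1 _)) scaler0.
  rewrite [in RHS](se N) ?leq_maxr // (lin_sum ((bilin_wedge D).1 e')).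
  by rewrite (lin_sum ((bilin_tensp _ _).2 _)).
- move=> n x; rewrite [LHS](sw_push _ _ lv) /= /vert_part !tmapE.
  rewrite sw_sw; last by linearity.
  apply: sw_eq => w e; rewrite sw_tensp; last by linearity.
  rewrite -[LHS]/(vert_part _).
  rewrite (lin_sum lv) big_ord_recl /= big1 ?addr0 => [|i _].
    by rewrite vert_part_pure cal_pr_gr subn0.
  by rewrite vert_part_pure cal_pr_gr (lin0 ((bilin_tensp _ _).1 _)).
- move=> x; rewrite [LHS](sw_push _ _ lv) /= /vert_part !tmapE.
  rewrite sw_sw; last by linearity.
  apply: sw_eq => w e; rewrite sw_tensp; last by linearity.
  rewrite -[LHS]/(vert_part _) (linD lv) vert_part_pure cal_pr_d.
  rewrite (lin0 ((bilin_tensp _ _).1 _)) add0r.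
  have [N vw] := gr_vanish w.
  rewrite (@fs_sumN _ N.+1) => [|p /ltnW /vw ->]; last first.
    by rewrite (lin0 ((bilin_tensp _ _).1 _)) scaler0.
  rewrite (lin_sum lv) big_ord_recl /= big1 ?addr0 => [|i _].
    by rewrite (linZ lv) vert_part_pure cal_pr_gr expr0 scale1r.
  by rewrite (linZ lv) vert_part_pure cal_pr_gr (lin0 ((bilin_tensp _ _).1 _))
    scaler0.
Qed.

End Vertical.

Section CompleteCalculus.
Variables (k : fieldType) (H : hopf k) (OmH : calculus H) (A : comodAlg H).
Variables (OmA : calculus A) (DA : OmA -> OmA \otimes OmH).
Hypothesis hDA : extends_coaction DA.

(** The extended coaction with values restricted to A (x) Omega(H); on A it is
    the coaction. *)
Definition vert_coact (w : OmA) : A \otimes OmH := vert_part (DA w).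

Lemma vert_coact_morphism :
  @dga_morphism k OmA (alg_forms A OmH) vert_coact.
Proof.
have [[dl d1 dm dg dd] _] := hDA.
have [vl v1 vm vg vd] := vert_part_morphism OmA OmH.
rewrite /vert_coact; split.
- by move=> c x y; rewrite dl vl.
- by rewrite d1 v1.
- by move=> x y; rewrite dm vm.
- by move=> n x; rewrite dg vg.
- by move=> x; rewrite dd vd.
Qed.

Lemma vert_coact_in a :
  vert_coact (cal_in OmA a) = tmap id (cal_in OmH) (coact a).
Proof.
have [_ e] := hDA; rewrite /vert_coact e (tmapE (cal_in _)).
rewrite (sw_push _ _ (lin_vert_part (OmA := OmA) (D := OmH))).
by apply: sw_eq => x h; rewrite vert_part_pure cal_inK.
Qed.

End CompleteCalculus.

(** * The antipode and coinvariant forms *)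

Section Hopf.
Variables (k : fieldType) (H : hopf k) (W : lmodType k).
Implicit Types (g h : H).

Lemma coprA_sw (f : H -> H -> H -> W) h : trilin f ->
  \sw_(h', h3 <- copr h) \sw_(h1, h2 <- copr h') f h1 h2 h3 =
  \sw_(h1, h' <- copr h) \sw_(h2, h3 <- copr h') f h1 h2 h3.
Proof.
move=> tf; have e := congr1 (sweedler (fun u s => sweedler (f u) s)) (coprA h).
rewrite sw_tassoc // !sw_tmap in e; last 2 first.
- by linearity.
- by linearity.
exact: e.
Qed.

Lemma counitl_sw (f : H -> W) h : lin f ->
  \sw_(x, y <- copr h) (counit x *: f y) = f h.
Proof.
move=> lf; rewrite -[in RHS](counitl h) (sw_push _ _ lf).
by apply: sw_eq => x y; rewrite (linZ lf).
Qed.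

Lemma counitr_sw (f : H -> W) h : lin f ->
  \sw_(x, y <- copr h) (counit y *: f x) = f h.
Proof.
move=> lf; rewrite -[in RHS](counitr h) (sw_push _ _ lf).
by apply: sw_eq => x y; rewrite (linZ lf).
Qed.

Lemma antipl_sw (f : H -> W) h : lin f ->
  \sw_(x, y <- copr h) f (antip x * y) = counit h *: f 1.
Proof. by move=> lf; rewrite -(linZ lf) -antipl (sw_push _ _ lf). Qed.

Lemma antipr_sw (f : H -> W) h : lin f ->
  \sw_(x, y <- copr h) f (x * antip y) = counit h *: f 1.
Proof. by move=> lf; rewrite -(linZ lf) -antipr (sw_push _ _ lf). Qed.

Lemma coprM_sw (f : H -> H -> W) g h : bilin f -> sweedler f (copr (g * h)) =
  \sw_(x, y <- copr g) \sw_(x', y' <- copr h) f (x * x') (y * y').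
Proof. by move=> bf; rewrite coprM sw_tmul2. Qed.

End Hopf.

Section Antipode.
Variables (k : fieldType) (H : hopf k).

(** What survives of the anticomultiplicativity Delta(S h) = S h_2 (x) S h_1
    after multiplying by h_2 (x) 1 on the right. In Sweedler notation
    Delta(S h_1) (h_2 (x) 1) = Delta(S h_1) (h_2 (x) h_3 S(h_4))
    = Delta(S(h_1) h_2) (1 (x) S(h_3)) = 1 (x) S(h). This is what makes
    S(w_{-1}) w_0 coinvariant. *)
Lemma copr_antip (h : H) :
  \sw_(h1, h2 <- copr h) tmul2 *%R *%R (copr (antip h1)) (h2 \ox 1) =
  (1 : H) \ox antip h.
Proof.
have bM := bilin_tmul2 (bilin_mul H) (bilin_mul H).
have MA := tmul2A (bilin_mul H) (bilin_mul H) (@mulrA H) (@mulrA H).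
have -> : (1 : H) \ox antip h = \sw_(h', h3 <- copr h) \sw_(h1, h2 <- copr h')
    tmul2 *%R *%R (copr (antip h1 * h2)) (1 \ox antip h3).
  rewrite -(counitl_sw (f := fun x => 1 \ox antip x)); last by linearity.
  apply: sw_eq => h' h3.
  rewrite (antipl_sw (f := fun x => tmul2 *%R *%R (copr x) (1 \ox antip h3)));
    last by linearity.
  rewrite copr1 tmul2_pure; [|linearity|linearity].
  by rewrite !mul1r.
transitivity (\sw_(h', h3 <- copr h) \sw_(h1, h2 <- copr h')
    \sw_(a, b <- copr h2) tmul2 *%R *%R (copr (antip h1)) (a \ox (b * antip
      h3))); last first.
  apply: sw_eq => h' h3; apply: sw_eq => h1 h2.
  rewrite coprM -MA -{2}(sw_id (copr h2)).
  rewrite (sw_push _ _ (bM.1 _)) (sw_push _ _ (bM.2 _)); apply: sw_eq => a b.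
  rewrite tmul2_pure; [|linearity|linearity].
  by rewrite mulr1.
rewrite coprA_sw; last by linearity.
apply: sw_eq => h1 h'; rewrite coprA_sw; last by linearity.
rewrite -(counitr_sw (f := fun x =>
  tmul2 *%R *%R (copr (antip h1)) (x \ox 1))); last by linearity.
apply: sw_eq => a h''; rewrite (antipr_sw
  (f := fun x => tmul2 *%R *%R (copr (antip h1)) (a \ox x))) //.
by linearity.
Qed.

End Antipode.

Section LeftCoaction.
Variables (k : fieldType) (H : hopf k) (OmH : calculus H).
Variable lam : {linear OmH -> H \otimes OmH}.
Hypothesis hlam : left_coaction lam.
Implicit Types (h : H) (w e : OmH) (th : linvForm lam).
Local Notation inc := (cal_in OmH).

Section Lifted.
Variable W : lmodType k.

Lemma lam_in_sw (f : H -> OmH -> W) h : bilin f ->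
  sweedler f (lam (inc h)) = \sw_(h1, h2 <- copr h) f h1 (inc h2).
Proof. by move=> bf; case: hlam => -> _ _; rewrite sw_tmap. Qed.

Lemma lam_wedge_sw (f : H -> OmH -> W) w e : bilin f ->
  sweedler f (lam (w \w e)) =
  \sw_(x, w' <- lam w) \sw_(y, e' <- lam e) f (x * y) (w' \w e').
Proof. by move=> bf; case: hlam => _ -> _; rewrite sw_tmul2. Qed.

Lemma lam_d_sw (f : H -> OmH -> W) w : bilin f ->
  sweedler f (lam (dga_d w)) = \sw_(x, w' <- lam w) f x (dga_d w').
Proof. by move=> bf; case: hlam => _ _ ->; rewrite sw_tmap. Qed.

Lemma lam_linv_sw (f : H -> OmH -> W) th : bilin f ->
  sweedler f (lam (val th)) = f 1 (val th).
Proof.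
by move=> bf; case: th => th /= /asboolP ->; rewrite sw_tensp.
Qed.

End Lifted.

(** The coproduct of an element of H stays in degree 0 and lam commutes with d,
    so lam preserves the degree on each a0 da1 ... dan. *)
Lemma lam_gr n w : lam (dga_gr n w) = tmap id (@dga_gr k OmH n) (lam w).
Proof.
have [lin_ lM ld] := hlam.
have lgr m : lin (tmap (@id H) (@dga_gr k OmH m)) by linearity.
elim/calculus_ind: w n => [n|x y ex ey n|h n|x h ex n].
- by rewrite (lin0 (@lin_gr k OmH n)) linear0 (lin0 (lgr n)).
- by rewrite (linD (@lin_gr k OmH n)) !linearD /= ex ey (linD (lgr n)).
- rewrite (gr_homog _ (cal_in_homog _ h)) lin_ !tmapE sw_sw; last by linearity.
  case: eqP => [->|/eqP n0].
    rewrite lin_ tmapE; apply: sw_eq => u v; rewrite sw_tensp;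
      last by linearity.
    by rewrite (gr_homog _ (cal_in_homog _ v)).
  rewrite linear0; apply/esym/sw_0 => u v; rewrite sw_tensp; last by linearity.
  rewrite (gr_homog _ (cal_in_homog _ v)) (negPf n0).
  exact: (lin0 ((bilin_tensp _ _).2 u)).
- have gx : bilin (fun (u : H) (v : OmH) => u \ox dga_gr n v) by linearity.
  rewrite wedge_gr; last exact: homog_d_in.
  rewrite tmapE lam_wedge_sw //.
  case: n gx => [|n] gx.
    rewrite linear0; apply/esym/sw_0 => u v; apply: etrans (lam_d_sw _ _) _;
      first by linearity.
    rewrite lam_in_sw; last by linearity.
    apply: sw_0 => u' v'; rewrite wedge_gr; last exact: homog_d_in.
    exact: (lin0 ((bilin_tensp _ _).2 _)).
  rewrite lM ex tmul2E tmapE sw_sw; last by linearity.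
  apply: sw_eq => u v; rewrite sw_tensp; last by linearity.
  rewrite !lam_d_sw; [|by linearity|by linearity].
  rewrite !lam_in_sw; [|by linearity|by linearity].
  by apply: sw_eq => u' v'; rewrite wedge_gr //; exact: homog_d_in.
Qed.

(** Coassociativity of lam is inherited from that of the coproduct, by
    multiplicativity of lam and its compatibility with d. *)
Lemma lam_coassoc (W : lmodType k) (f : H -> H -> OmH -> W) w : trilin f ->
  \sw_(h', e <- lam w) \sw_(h1, h2 <- copr h') f h1 h2 e =
  \sw_(h1, w' <- lam w) \sw_(h2, e <- lam w') f h1 h2 e.
Proof.
have P0 (g : H -> H -> OmH -> W) : trilin g ->
    lin (fun w => \sw_(h', e <- lam w) \sw_(h1, h2 <- copr h') g h1 h2 e) /\
    lin (fun w => \sw_(h1, w' <- lam w) \sw_(h2, e <- lam w') g h1 h2 e).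
  by move=> tg; split; linearity.
elim/calculus_ind: w f => [|x y ex ey|h|x h ex] f tf; have [l1 l2] := P0 f tf.
- by rewrite (lin0 l1) (lin0 l2).
- by rewrite (linD l1) (linD l2) ex // ey.
- rewrite !lam_in_sw; [|by linearity|by linearity].
  rewrite coprA_sw; last by linearity.
  by apply: sw_eq => u v; rewrite lam_in_sw //; linearity.
- rewrite !lam_wedge_sw; [|by linearity|by linearity].
  transitivity (\sw_(g, w <- lam x) \sw_(a, b <- copr g)
      \sw_(h', h3 <- copr h) \sw_(a', b' <- copr h')
        f (a * a') (b * b') (w \w dga_d (inc h3))).
    apply: sw_eq => g w; rewrite lam_d_sw; last by linearity.
    rewrite lam_in_sw; last by linearity.
    rewrite (sw_exch (fun a b => fun h' h3 => _)).
    apply: sw_eq => h' h3; rewrite coprM_sw //; linearity.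
  rewrite ex; last by linearity.
  apply: sw_eq => a w; rewrite lam_d_sw; last by linearity.
  rewrite lam_in_sw; last by linearity.
  transitivity (\sw_(b, w' <- lam w) \sw_(a', g <- copr h)
      \sw_(b', h3 <- copr g) f (a * a') (b * b') (w' \w dga_d (inc h3))).
    by apply: sw_eq => b w'; rewrite coprA_sw //; linearity.
  rewrite (sw_exch (fun b w' => fun a' g => _)).
  apply: sw_eq => a' g; rewrite lam_wedge_sw; last by linearity.
  apply: sw_eq => b w'; rewrite lam_d_sw; last by linearity.
  by rewrite lam_in_sw //; linearity.
Qed.

(** S(w_{-1}) w_0, the form underlying pi_inv w. *)
Definition coinv_part w : OmH := \sw_(h, e <- lam w) (inc (antip h) \w e).

Lemma lin_coinv_part : lin coinv_part.
Proof. by rewrite /coinv_part; linearity. Qed.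

(** By coassociativity lam (S(w_{-1}) w_0) is Delta(S(w_{-2})) (w_{-1} (x) 1)
    times 1 (x) w_0, and [copr_antip] evaluates the first factor to
    1 (x) S(w_{-1}). *)
Lemma coinv_part_coinv w : lam (coinv_part w) = 1 \ox coinv_part w.
Proof.
have [lin_ lM ld] := hlam.
have llam : lin (fun w => lam w) by linearity.
rewrite /coinv_part (sw_push _ _ llam).
(* M h1 h2 e is Delta(S h1) (h2 (x) 1) times 1 (x) e. *)
pose M h1 h2 e :=
  \sw_(x, y <- tmul2 *%R *%R (copr (antip h1)) (h2 \ox 1))
    (x \ox (inc y \w e)).
transitivity (\sw_(h', e <- lam w) \sw_(h1, h2 <- copr h') M h1 h2 e).
  rewrite lam_coassoc; last by rewrite /M; linearity.
  apply: sw_eq => h e; rewrite lM lin_ -[in LHS](sw_id (lam e)).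
  rewrite (sw_push _ _ ((bilin_tmul2 (bilin_mul H) (bilin_wedge OmH)).2 _)).
  apply: sw_eq => b e'; rewrite /M tmul2E tmapE sw_sw; last by linearity.
  rewrite sw_tmul2; last by linearity.
  apply: sw_eq => x y; rewrite !sw_tensp;
    [|by linearity|by linearity|by linearity].
  by rewrite mulr1.
rewrite (sw_push _ _ ((bilin_tensp _ _).2 _)); apply: sw_eq => h e.
rewrite /M -sw_sw; last by linearity.
by rewrite copr_antip sw_tensp //; linearity.
Qed.

Lemma to_linvK w : lam w = 1 \ox w -> val (to_linv lam w) = w.
Proof. by move=> e; rewrite /to_linv insubdK //; apply/asboolP. Qed.

Lemma val_linvE th : lam (val th) = 1 \ox val th.
Proof. by case: th => th /= /asboolP. Qed.

Lemma lin_val : lin (val : linvForm lam -> OmH).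
Proof. by move=> c x y. Qed.

Lemma val_pi_inv w : val (Defs.pi_inv lam w) = coinv_part w.
Proof. by rewrite /Defs.pi_inv to_linvK //; apply: coinv_part_coinv. Qed.

Lemma lin_pi_inv : lin (Defs.pi_inv lam).
Proof.
move=> c x y; apply: val_inj; rewrite lin_val !val_pi_inv.
exact: lin_coinv_part.
Qed.

Lemma val_linv_mul th et : val (linv_mul th et) = val th \w val et.
Proof.
have [_ lM _] := hlam; rewrite /linv_mul to_linvK // lM !val_linvE.
by rewrite tmul2_pure ?mulr1 //; linearity.
Qed.

Lemma lam1 : lam (dga_one OmH) = 1 \ox dga_one OmH.
Proof.
have [li _ _] := hlam; rewrite -cal_in1 li copr1 tmap_pure //; linearity.
Qed.

Lemma val_linv1 : val (to_linv lam (dga_one OmH)) = dga_one OmH.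
Proof. by rewrite to_linvK // lam1. Qed.

Lemma val_linv_d th : val (to_linv lam (dga_d (val th))) = dga_d (val th).
Proof.
have [_ _ ld] := hlam; rewrite to_linvK // ld val_linvE tmap_pure //; linearity.
Qed.

Lemma val_linv_gr n th :
  val (to_linv lam (dga_gr n (val th))) = dga_gr n (val th).
Proof. by rewrite to_linvK // lam_gr val_linvE tmap_pure //; linearity. Qed.

(** S(h_1) th h_2 is the coinvariant part of th h, and is therefore
    coinvariant. *)
Lemma val_linv_act th h : val (linv_act th h) =
  \sw_(h1, h2 <- copr h) (inc (antip h1) \w val th \w inc h2).
Proof.
rewrite /linv_act; set t := tlift _ _.
have -> : t = coinv_part (val th \w inc h).
  rewrite /coinv_part lam_wedge_sw; last by linearity.
  rewrite lam_linv_sw; last by linearity.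
  rewrite lam_in_sw; last by linearity.
  by apply: sw_eq => u v; rewrite mul1r (dga_mulA (dga_ax OmH)).
rewrite to_linvK; last exact: coinv_part_coinv.
rewrite /coinv_part lam_wedge_sw; last by linearity.
rewrite lam_linv_sw; last by linearity.
rewrite lam_in_sw; last by linearity.
by apply: sw_eq => u v; rewrite mul1r (dga_mulA (dga_ax OmH)).
Qed.

Lemma varpiE h : varpi lam h = Defs.pi_inv lam (dga_d (inc h)).
Proof.
rewrite /varpi /Defs.pi_inv; congr to_linv; apply/esym.
apply: etrans (lam_d_sw (f := fun h e => inc (antip h) \w e) _ _) _;
  first by linearity.
by rewrite lam_in_sw //; linearity.
Qed.

Lemma val_varpi h : val (varpi lam h) =
  \sw_(h1, h2 <- copr h) (inc (antip h1) \w dga_d (inc h2)).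
Proof.
rewrite varpiE val_pi_inv /coinv_part lam_d_sw; last by linearity.
by rewrite lam_in_sw //; linearity.
Qed.

(** The constant term eps(h) 1 is invisible to varpi, because d 1 = 0. *)
Lemma varpi_eps h : varpi lam (pi_eps h) = varpi lam h.
Proof.
have lv : lin (fun h => varpi lam h).
  by move=> c x y; rewrite !varpiE linearP (@lin_d k OmH) lin_pi_inv.
rewrite /pi_eps -scaleNr addrC lv.
have -> : varpi lam (1 : H) = 0.
  by rewrite varpiE cal_in1 d_one (lin0 lin_pi_inv).
by rewrite scaler0 add0r.
Qed.

(** h_1 S(h_2) th h_3 = th h: a coinvariant form passes to the right of h at
    the price of the right action. *)
Lemma linv_act_sw th h :
  \sw_(h1, h2 <- copr h) (inc h1 \w val (linv_act th h2)) = val th \w inc h.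
Proof.
have ax := dga_ax OmH.
transitivity (\sw_(h1, h' <- copr h) \sw_(h2, h3 <- copr h')
    (inc (h1 * antip h2) \w (val th \w inc h3))).
  apply: sw_eq => h1 h';
    rewrite val_linv_act (sw_push _ _ ((bilin_wedge OmH).2 _)).
  by apply: sw_eq => h2 h3; rewrite cal_inM !(dga_mulA ax).
rewrite -coprA_sw; last by linearity.
rewrite -[RHS](counitl_sw (f := fun h => val th \w inc h)); last by linearity.
apply: sw_eq => h' h3.
rewrite (antipr_sw (f := fun x => inc x \w (val th \w inc h3)));
  last by linearity.
by rewrite cal_in1 (dga_mul1l ax).
Qed.

(** h_1 S(h_2) dh_3 = dh. *)
Lemma varpi_sw h :
  \sw_(h1, h2 <- copr h) (inc h1 \w val (varpi lam h2)) = dga_d (inc h).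
Proof.
have ax := dga_ax OmH.
transitivity (\sw_(h1, h' <- copr h) \sw_(h2, h3 <- copr h')
    (inc (h1 * antip h2) \w dga_d (inc h3))).
  apply: sw_eq => h1 h';
    rewrite val_varpi (sw_push _ _ ((bilin_wedge OmH).2 _)).
  by apply: sw_eq => h2 h3; rewrite cal_inM !(dga_mulA ax).
rewrite -coprA_sw; last by linearity.
rewrite -[RHS](counitl_sw (f := fun h => dga_d (inc h))); last by linearity.
apply: sw_eq => h' h3.
rewrite (antipr_sw (f := fun x => inc x \w dga_d (inc h3))); last by linearity.
by rewrite cal_in1 (dga_mul1l ax).
Qed.

(** S(h_1) h_2 th = eps(h) th, as the left coaction of h th only splits h. *)
Lemma pi_inv_inM h th :
  Defs.pi_inv lam (inc h \w val th) = (counit h : k) *: th.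
Proof.
have ax := dga_ax OmH.
apply: val_inj; rewrite val_pi_inv (linZ lin_val) /coinv_part.
rewrite lam_wedge_sw; last by linearity.
rewrite lam_in_sw; last by linearity.
transitivity (\sw_(h1, h2 <- copr h) (inc (antip h1 * h2) \w val th)).
  apply: sw_eq => h1 h2; rewrite lam_linv_sw; last by linearity.
  by rewrite mulr1 cal_inM (dga_mulA ax).
rewrite (antipl_sw (f := fun x => inc x \w val th)); last by linearity.
by rewrite cal_in1 (dga_mul1l ax).
Qed.

Lemma pi_inv_val th : Defs.pi_inv lam (val th) = th.
Proof.
rewrite -[val th](dga_mul1l (dga_ax OmH)) -cal_in1 pi_inv_inM.
by rewrite counit1 scale1r.
Qed.

End LeftCoaction.

(** * Vertical forms inside forms on H with coefficients in A *)

Section Coaction.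
Variables (k : fieldType) (H : hopf k) (A : comodAlg H) (W : lmodType k).
Implicit Types a b : A.

Lemma coactA_sw (f : A -> H -> H -> W) a : trilin f ->
  \sw_(a', h2 <- coact a) \sw_(a0, h1 <- coact a') f a0 h1 h2 =
  \sw_(a0, h <- coact a) \sw_(h1, h2 <- copr h) f a0 h1 h2.
Proof.
move=> tf; have e := congr1 (sweedler (fun u s => sweedler (f u) s)) (coactA a).
rewrite sw_tassoc // !sw_tmap in e; last 2 first.
- by linearity.
- by linearity.
exact: e.
Qed.

Lemma coact_counit_sw (f : A -> W) a : lin f ->
  \sw_(x, h <- coact a) ((counit h : k) *: f x) = f a.
Proof.
move=> lf; rewrite -[in RHS](coact_counit a) (sw_push _ _ lf).
by apply: sw_eq => x y; rewrite (linZ lf).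
Qed.

Lemma coactM_sw (f : A -> H -> W) a b : bilin f -> sweedler f (coact (a * b)) =
  \sw_(x, g <- coact a) \sw_(y, h <- coact b) f (x * y) (g * h).
Proof. by move=> bf; rewrite coactM sw_tmul2. Qed.

Lemma sweedler3_sw (f : A -> H -> H -> W) a : trilin f ->
  sweedler3 a f = \sw_(a0, h <- coact a) \sw_(h1, h2 <- copr h) f a0 h1 h2.
Proof.
move=> tf; rewrite -coactA_sw //;
  apply: (sw_tmap (f := fun t h => \sw_(x, y <- t) f x y h)).
linearity.
Qed.

End Coaction.

Section Vertical.
Variables (k : fieldType) (H : hopf k) (OmH : calculus H).
Variable lam : {linear OmH -> H \otimes OmH}.
Hypothesis hlam : left_coaction lam.
Variable A : comodAlg H.
Local Notation inc := (cal_in OmH).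
Local Notation Ver := (A \otimes linvForm lam).
Let ax := dga_ax OmH.
Implicit Types (th : linvForm lam) (w : OmH).

(** Identifies ver(A) with the cotensor product of A and Omega(H) inside
    A (x) Omega(H). *)
Definition ver_emb (v : Ver) : A \otimes OmH :=
  \sw_(a, th <- v) \sw_(a0, a1 <- coact a) (a0 \ox (inc a1 \w val th)).

Definition ver_proj : A \otimes OmH -> Ver := tmap id (Defs.pi_inv lam).

Let lval : lin (fun th : linvForm lam => val th) := @lin_val _ _ _ lam.
Let lpi : lin (fun w => Defs.pi_inv lam w) := lin_pi_inv hlam.

Lemma lin_ver_emb : lin ver_emb.
Proof. have lv := lval; rewrite /ver_emb; linearity. Qed.

Lemma lin_ver_proj : lin ver_proj.
Proof. have lv := lpi; rewrite /ver_proj; linearity. Qed.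

Lemma ver_emb_pure (a : A) th :
  ver_emb (a \ox th) = \sw_(a0, a1 <- coact a) (a0 \ox (inc a1 \w val th)).
Proof. have lv := lval; by rewrite /ver_emb sw_tensp //; linearity. Qed.

Lemma ver_proj_pure (a : A) w : ver_proj (a \ox w) = a \ox Defs.pi_inv lam w.
Proof. have lv := lpi; by rewrite /ver_proj tmap_pure //; linearity. Qed.

Lemma ver_embK : cancel ver_emb ver_proj.
Proof.
have le := lin_ver_emb; have lp := lin_ver_proj.
apply: tensor_ext; [by linearity|by linearity|] => a th.
rewrite ver_emb_pure (sw_push _ _ lp).
rewrite -[RHS](coact_counit_sw (f := fun a => a \ox th)); last by linearity.
apply: sw_eq => a0 a1; rewrite ver_proj_pure pi_inv_inM //.
by rewrite (linZ ((bilin_tensp _ _).2 _)).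
Qed.

Lemma ver_emb_inj : injective ver_emb.
Proof. exact: can_inj ver_embK. Qed.

Lemma lin_val_linv_act th : lin (fun h => val (linv_act th h)).
Proof.
by move=> c x y; rewrite !val_linv_act // linearP; apply: lin_sweedler;
  linearity.
Qed.

(** The twist by the right action of H is absorbed by [linv_act_sw] and the
    term of the differential with varpi by [varpi_sw]. *)
Lemma ver_emb_morphism : @dga_morphism k (ver lam A) (alg_forms A OmH) ver_emb.
Proof.
have le := lin_ver_emb; have lv := lval; split.
- by move=> c x y; apply: le.
- rewrite [LHS]ver_emb_pure coact1 sw_tensp; last by linearity.
  by rewrite val_linv1 // cal_in1 (dga_mul1l ax).
- move=> s t; rewrite [LHS](sw_push _ _ le) /= tmul2E {2}/ver_emb.
  rewrite sw_sw; last by linearity.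
  apply: sw_eq => a th.
  rewrite sw_sw; last by linearity.
  transitivity (\sw_(b, et <- t) \sw_(a0, a1 <- coact a) \sw_(b0, b1 <- coact b)
    ((a0 * b0) \ox (inc a1 \w (val th \w inc b1) \w val et))); last first.
    rewrite (sw_exch (fun b et => fun a0 a1 => _)); apply: sw_eq => a0 a1.
    rewrite sw_tensp; last by linearity.
    rewrite /ver_emb sw_sw; last by linearity.
    apply: sw_eq => b et; rewrite sw_sw; last by linearity.
    by apply: sw_eq => b0 b1; rewrite sw_tensp ?(dga_mulA ax) //; linearity.
  rewrite [LHS](sw_push _ _ le); apply: sw_eq => b et.
  rewrite [LHS](sw_push _ _ le).
  have la := lin_val_linv_act th.
  transitivity (\sw_(a0, a1 <- coact a) \sw_(b', b1 <- coact b)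
      \sw_(b00, b01 <- coact b')
      ((a0 * b00) \ox
         (inc a1 \w ((inc b01 \w val (linv_act th b1)) \w val et)))).
    rewrite (sw_exch (fun a0 a1 => fun b' b1 => _)); apply: sw_eq => b' b1.
    rewrite ver_emb_pure coactM_sw; last by linearity.
    apply: sw_eq => a0 a1; apply: sw_eq => b00 b01.
    by rewrite val_linv_mul // cal_inM !(dga_mulA ax).
  apply: sw_eq => a0 a1; rewrite coactA_sw; last by linearity.
  apply: sw_eq => b0 b1; rewrite -(dga_mulA ax) -linv_act_sw //.
  have l1 : lin (fun x => (a0 * b0) \ox (inc a1 \w (x \w val et))) by linearity.
  by rewrite [RHS](sw_push _ _ l1).
- move=> n x; rewrite [LHS](sw_push _ _ le) /=.
  rewrite tmapE /ver_emb sw_sw; last by linearity.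
  apply: sw_eq => a th; rewrite sw_sw; last by linearity.
  rewrite -[LHS]/(ver_emb _) ver_emb_pure; apply: sw_eq => a0 a1.
  rewrite sw_tensp; last by linearity.
  by rewrite val_linv_gr // -(gr_wedge_homog n _ (cal_in_homog _ a1)).
- move=> x; rewrite [LHS](sw_push _ _ le) /=.
  rewrite tmapE {2}/ver_emb sw_sw; last by linearity.
  apply: sw_eq => a th; rewrite sw_sw; last by linearity.
  rewrite (linD le) ver_emb_pure val_linv_d // [X in _ + X](sw_push _ _ le).
  have lvp : lin (fun h => val (varpi lam h)).
    by move=> c u v; rewrite !varpiE // !val_pi_inv // linearP (@lin_d k OmH)
      (lin_coinv_part lam).
  transitivity (\sw_(a0, a1 <- coact a) (a0 \ox (inc a1 \w dga_d (val th))) +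
     \sw_(a0, a1 <- coact a) (a0 \ox (dga_d (inc a1) \w val th))).
    congr (_ + _).
    transitivity (\sw_(a', h2 <- coact a) \sw_(a0, h1 <- coact a')
       (a0 \ox ((inc h1 \w val (varpi lam h2)) \w val th))).
      apply: sw_eq => a' h2; rewrite ver_emb_pure; apply: sw_eq => a0 h1.
      by rewrite val_linv_mul // varpi_eps // (dga_mulA ax).
    rewrite coactA_sw; last by linearity.
    apply: sw_eq => a0 h; rewrite -(varpi_sw hlam).
    have l1 : lin (fun x => a0 \ox (x \w val th)) by linearity.
    by rewrite [RHS](sw_push _ _ l1).
  rewrite -sw_add; apply: sw_eq => a0 a1; rewrite sw_tensp; last by linearity.
  rewrite (dga_leibniz ax _ (cal_in_homog _ a1)) expr0 scale1r addrC.
  by rewrite tenspDr.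
Qed.

End Vertical.

(** * The vertical map *)

Section Main.
Variables (k : fieldType) (H : hopf k) (OmH : calculus H).
Variable lam : {linear OmH -> H \otimes OmH}.
Hypothesis hlam : left_coaction lam.
Variable A : comodAlg H.
Variables (OmA : calculus A) (DA : OmA -> OmA \otimes OmH).
Hypothesis hDA : extends_coaction DA.
Local Notation inc := (cal_in OmH).
Local Notation Ver := (A \otimes linvForm lam).
Local Notation "s ** t" := (tmul2 *%R (@dga_mul k OmH) s t) (at level 40).
Local Notation F := (vert_coact DA).
Let ax := dga_ax OmH.
Implicit Types (th : linvForm lam).

Let bM := bilin_tmul2 (bilin_mul A) (bilin_wedge OmH).
Let MA : associative (tmul2 *%R (@dga_mul k OmH)) :=
  tmul2A (bilin_mul A) (bilin_wedge OmH) (@mulrA A) (dga_mulA ax).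
Let lF : lin F := dgam_lin (vert_coact_morphism hDA).
Let FM : forall x y, F (x \w y) = F x ** F y :=
  dgam_mul (vert_coact_morphism hDA).
Let Fd : forall x, F (dga_d x) = tmap id (@dga_d k OmH) (F x) :=
  dgam_d (vert_coact_morphism hDA).
Let F_in := vert_coact_in hDA.
Let lE := @lin_ver_emb k H OmH lam A.
Let lP := @lin_ver_proj k H OmH lam hlam A.
Let E_morph := ver_emb_morphism hlam A.

Lemma ver_dga : is_dga (ver lam A).
Proof.
exact: (@is_dga_transfer k (ver lam A) (alg_forms A OmH)
  (@ver_emb k H OmH lam A)
  (alg_forms_dga A OmH) (@ver_emb_inj _ _ _ _ hlam A) E_morph).
Qed.

Lemma vert_coact_in_emb (a : A) :
  F (cal_in OmA a) = ver_emb (a \ox to_linv lam (dga_one OmH)).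
Proof.
rewrite F_in ver_emb_pure tmapE; apply: sw_eq => a0 a1.
by rewrite val_linv1 // (dga_mul1r ax).
Qed.

(** The image of [ver_emb] is closed under the product and d and contains the
    values of [vert_coact] on A. *)
Lemma vert_coact_im_emb w : exists v : Ver, ver_emb v = F w.
Proof.
elim/calculus_ind: w => [|x y [v ev] [u eu]|a|x a [v ev]].
- by exists 0; rewrite (lin0 lE) (lin0 lF).
- by exists (v + u); rewrite (linD lE) (linD lF) ev eu.
- by exists (a \ox to_linv lam (dga_one OmH)); rewrite vert_coact_in_emb.
- pose u : ver lam A := a \ox to_linv lam (dga_one OmH).
  exists (dga_mul (v : ver lam A) (dga_d u)).
  rewrite (dgam_mul E_morph) (dgam_d E_morph) FM Fd vert_coact_in_emb -ev.
  by [].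
Qed.

Definition vert_map (w : OmA) : ver lam A := ver_proj lam (F w).

Lemma emb_vert_map w : ver_emb (vert_map w) = F w.
Proof.
by have [v ev] := vert_coact_im_emb w; rewrite /vert_map -ev (ver_embK hlam).
Qed.

Lemma vert_map_morphism : dga_morphism vert_map.
Proof.
have inj := @ver_emb_inj _ _ _ _ hlam A.
have [fl f1 fM fg fd] := vert_coact_morphism hDA.
have [el e1 eM eg ed] := E_morph.
split.
- by move=> c x y; rewrite /vert_map lF lP.
- by apply: inj; rewrite emb_vert_map f1 e1.
- by move=> x y; apply: inj; rewrite eM !emb_vert_map fM.
- by move=> n x; apply: inj; rewrite eg !emb_vert_map fg.
- by move=> x; apply: inj; rewrite ed !emb_vert_map fd.
Qed.

Lemma vert_map_in (a : A) :
  vert_map (cal_in OmA a) = a \ox to_linv lam (dga_one OmH).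
Proof. by rewrite /vert_map vert_coact_in_emb (ver_embK hlam). Qed.

(** [vert_coact] preserves the degree, so that the projection on degree n does
    not change its value at a form of degree n. *)
Lemma vert_map_formula n w : homog n w -> vert_map w = ver_formula lam DA n w.
Proof.
move=> hw; have [_ _ _ fg _] := vert_coact_morphism hDA.
have lp := lin_pi_inv hlam.
rewrite /vert_map -[in LHS]hw fg /= /ver_proj /vert_coact /vert_part
  /ver_formula.
rewrite !tmapE sw_sw; last by linearity.
rewrite sw_sw; last by linearity.
apply: sw_eq => x e; rewrite sw_tensp; last by linearity.
by rewrite sw_tensp //; linearity.
Qed.

(** The coaction is multiplicative, so multiplying the first factor by a is
    the product by a (x) 1 in ver(A). *)
Lemma emb_left_mul (a : A) (v : Ver) :
  ver_emb (tmap ( *%R a) id v) = F (cal_in OmA a) ** ver_emb v.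
Proof.
have lv : lin (fun th : linvForm lam => val th) := @lin_val _ _ _ lam.
have le := lE.
move: v; apply: tensor_ext; [by linearity|by linearity|] => b th.
rewrite tmap_pure; [|by linearity|by linearity].
rewrite F_in !ver_emb_pure coactM_sw; last by linearity.
rewrite tmul2E sw_tmap; last by linearity.
apply: sw_eq => a0 a1; rewrite sw_sw; last by linearity.
apply: sw_eq => b0 b1; rewrite sw_tensp; last by linearity.
by rewrite cal_inM (dga_mulA ax).
Qed.

Lemma vert_map_left_mul (a : A) w :
  vert_map (cal_in OmA a \w w) = tmap ( *%R a) id (vert_map w : Ver).
Proof.
apply: (@ver_emb_inj _ _ _ _ hlam A).
by rewrite emb_left_mul !emb_vert_map FM.
Qed.

Lemma proj_left_mul (a : A) t :
  ver_proj lam ((a \ox dga_one OmH) ** t) = tmap ( *%R a) id (ver_proj lam t).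
Proof.
have lp := lP.
move: t; apply: tensor_ext; [by linearity|by linearity|] => b w.
rewrite tmul2_pure; [|by linearity|by linearity].
rewrite !(ver_proj_pure hlam) (dga_mul1l ax) tmap_pure //; linearity.
Qed.

(** The left A-submodule of A (x) Omega(H) generated by the image of
    [vert_coact]. *)
Definition left_span (t : A \otimes OmH) : Prop :=
  exists r : seq (A * OmA), t = \sum_(p <- r) (p.1 \ox dga_one OmH) ** F p.2.

Lemma left_spanD s t : left_span s -> left_span t -> left_span (s + t).
Proof. by move=> [r ->] [q ->]; exists (r ++ q); rewrite big_cat. Qed.

Lemma left_span_sum I (r : seq I) (f : I -> A \otimes OmH) :
  (forall i, left_span (f i)) -> left_span (\sum_(i <- r) f i).
Proof.
move=> sf; apply: big_rec => [|i t _]; last exact: left_spanD.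
by exists [::]; rewrite big_nil.
Qed.

Lemma left_span_mul t y : left_span t -> left_span (t ** F y).
Proof.
move=> [r ->]; rewrite (lin_sum (bM.1 _)); apply: left_span_sum => p.
by exists [:: (p.1, p.2 \w y)]; rewrite big_seq1 /= FM MA.
Qed.

Hypothesis hgal : bijective (@galois_map k H A).

(** Surjectivity of the Galois map, at 1 (x) h only: the other tensors follow
    by left multiplication. *)
Lemma galois_sum (h : H) : exists r : seq (A * A),
  \sum_(p <- r) \sw_(x, g <- coact p.2) ((p.1 * x) \ox g) = 1 \ox h.
Proof.
have [g _ gK] := hgal.
(* The Galois map is by definition the sum over a representative. *)
exists (repr (g (1 \ox h))); rewrite -[RHS]gK; exact: erefl.
Qed.

Lemma one_ox_gen (h : H) : exists r : seq (A * A),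
  1 \ox inc h = \sum_(p <- r) (p.1 \ox dga_one OmH) ** F (cal_in OmA p.2).
Proof.
have [r er] := galois_sum h; exists r.
have li : lin (tmap (@id A) inc) by linearity.
have -> : (1 : A) \ox inc h = tmap id inc (1 \ox h).
  by rewrite tmap_pure //; linearity.
rewrite -er (lin_sum li); apply: eq_bigr => p _.
rewrite F_in (sw_push _ _ li) [in RHS]tmapE (sw_push _ _ (bM.2 _)).
apply: sw_eq => x g; rewrite tmap_pure; [|by linearity|by linearity].
rewrite tmul2_pure; [|by linearity|by linearity].
by rewrite (dga_mul1l ax).
Qed.

(** By induction on w: a (x) (x dh) is (a (x) x) (1 (x) dh), where 1 (x) dh is
    the sum of (p (x) 1) F(dq), and (a (x) x) (p (x) 1) = ap (x) x is in the
    span by induction, for the coefficient ap instead of a. The span is stable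
    under right multiplication by values of F. *)
Lemma left_span_all (w : OmH) (a : A) : left_span (a \ox w).
Proof.
elim/calculus_ind: w a => [a|x y ex ey a|h a|x h ex a].
- by exists [::]; rewrite big_nil (lin0 ((bilin_tensp _ _).2 _)).
- by rewrite tenspDr; apply: left_spanD.
- have [r er] := one_ox_gen h.
  have -> : a \ox inc h = (a \ox dga_one OmH) ** (1 \ox inc h).
    rewrite tmul2_pure; [|by linearity|by linearity];
      by rewrite mulr1 (dga_mul1l ax).
  rewrite er (lin_sum (bM.2 _)); apply: left_span_sum => p.
  exists [:: (a * p.1, cal_in OmA p.2)]; rewrite big_seq1 /= MA.
  rewrite tmul2_pure; [|by linearity|by linearity].
  by rewrite (dga_mul1l ax).
- have [r er] := one_ox_gen h.
  have ld : lin (tmap (@id A) (@dga_d k OmH)) by linearity.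
  have edh : (1 : A) \ox dga_d (inc h) =
      \sum_(p <- r) (p.1 \ox dga_one OmH) ** F (dga_d (cal_in OmA p.2)).
    have -> : (1 : A) \ox dga_d (inc h) = tmap id (@dga_d k OmH) (1 \ox inc h).
      by rewrite tmap_pure //; linearity.
    rewrite er (lin_sum ld); apply: eq_bigr => p _; rewrite Fd.
    move: (F _); apply: tensor_ext; [by linearity|by linearity|] => b e.
    rewrite tmul2_pure; [|by linearity|by linearity].
    rewrite !tmap_pure; [|by linearity|by linearity|by linearity|by linearity].
    rewrite tmul2_pure; [|by linearity|by linearity].
    by rewrite !(dga_mul1l ax).
  have -> : a \ox (x \w dga_d (inc h)) = (a \ox x) ** (1 \ox dga_d (inc h)).
    rewrite tmul2_pure; [|by linearity|by linearity]; by rewrite mulr1.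
  rewrite edh (lin_sum (bM.2 _)); apply: left_span_sum => p.
  rewrite MA; apply: left_span_mul.
  rewrite tmul2_pure; [|by linearity|by linearity].
  by rewrite (dga_mul1r ax); apply: ex.
Qed.

(** Writing a (x) th as the sum of (p (x) 1) F(w) and applying id (x) pi_inv
    gives a (x) th = vert_map (sum of p w). *)
Lemma vert_map_surj (v : Ver) : exists w, vert_map w = v.
Proof.
have lpv : lin vert_map by exact: dgam_lin vert_map_morphism.
elim/tensor_ind: v => [|s t [x ex] [y ey]|a th].
- by exists 0; rewrite (lin0 lpv).
- by exists (x + y); rewrite (linD lpv) ex ey.
have [r er] := left_span_all (val th) a.
exists (\sum_(p <- r) cal_in OmA p.1 \w p.2).
rewrite -[RHS](_ : ver_proj lam (a \ox val th) = _); last first.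
  by rewrite (ver_proj_pure hlam) pi_inv_val.
rewrite er (lin_sum lpv) (lin_sum lP); apply: eq_bigr => p _.
by rewrite vert_map_left_mul proj_left_mul.
Qed.

End Main.

(** * The explicit formula *)

Section Explicit.
Variables (k : fieldType) (H : hopf k) (OmH : calculus H).
Variable lam : {linear OmH -> H \otimes OmH}.
Hypothesis hlam : left_coaction lam.
Variable A : comodAlg H.
Variables (OmA : calculus A) (DA : OmA -> OmA \otimes OmH).
Hypothesis hDA : extends_coaction DA.
Local Notation inc := (cal_in OmH).
Local Notation F := (vert_coact DA).

Lemma trilin_ver_explicit_rec (s : seq A) :
  trilin (@ver_explicit_rec k H OmH A s).
Proof.
elim: s => [|b s IHs] /=; first by linearity.
have E x h w : sweedler3 b (fun b0 b1 b2 =>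
      ver_explicit_rec s (x * b0) (h * b1) (w \w dga_d (inc b2))) =
    \sw_(b0, g <- coact b) \sw_(b1, b2 <- copr g)
      ver_explicit_rec s (x * b0) (h * b1) (w \w dga_d (inc b2)).
  by rewrite sweedler3_sw //; linearity.
pose R x h w := \sw_(b0, g <- coact b) \sw_(b1, b2 <- copr g)
  ver_explicit_rec s (x * b0) (h * b1) (w \w dga_d (inc b2)).
have [R1 R2 R3] : trilin R by rewrite /R; linearity.
split=> [h w|x w|x h] c u v; rewrite !E.
- exact: (R1 h w c u v).
- exact: (R2 x w c u v).
- exact: (R3 x h c u v).
Qed.

(** The tail s of the recursion of the explicit formula, started from the
    decomposition x (x) w_{-1} (x) w_0 of a tensor x (x) w. For s empty it is
    id (x) pi_inv ([val_vert_map]). *)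
Definition eval_rec (s : seq A) (t : A \otimes OmH) : A \otimes OmH :=
  \sw_(x, w <- t) \sw_(h, e <- lam w) ver_explicit_rec s x h e.

(** One more differential db in the recursion amounts to multiplying by
    b_0 (x) d b_1 beforehand, as lam (w db_1) = w_{-1} b_1 (x) w_0 db_2. *)
Lemma eval_rec_cons b s t :
  eval_rec (b :: s) t =
  eval_rec s (tmul2 *%R (@dga_mul k OmH) t
                (tmap id (@dga_d k OmH) (tmap id inc (coact b)))).
Proof.
have tr := trilin_ver_explicit_rec s.
rewrite /eval_rec sw_tmul2; last by linearity.
apply: sw_eq => x w; rewrite sw_tmap; last by linearity.
rewrite sw_tmap; last by linearity.
transitivity (\sw_(h, e <- lam w) \sw_(b', g <- coact b) \sw_(b1, b2 <- copr g)
   ver_explicit_rec s (x * b') (h * b1) (e \w dga_d (inc b2))).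
  by apply: sw_eq => h e; rewrite /= sweedler3_sw //; linearity.
rewrite (sw_exch (fun h e => fun b' g => _)); apply: sw_eq => b' g.
rewrite lam_wedge_sw //; last by linearity.
apply: sw_eq => h e; rewrite lam_d_sw //; last by linearity.
by rewrite lam_in_sw //; linearity.
Qed.

Lemma eval_rec_dform (s : seq A) (y : OmA) :
  eval_rec s (F y) =
  eval_rec [::] (F (foldl (fun w a => w \w dga_d (cal_in OmA a)) y s)).
Proof.
have [_ _ FM _ Fd] := vert_coact_morphism hDA.
elim: s y => //= b s IHs y.
by rewrite -IHs FM Fd (vert_coact_in hDA) eval_rec_cons.
Qed.

Lemma val_vert_map w :
  tmap id (@linv_val k H OmH lam) (vert_map lam DA w) = eval_rec [::] (F w).
Proof.
have lv : lin (@linv_val k H OmH lam) := @lin_val _ _ _ lam.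
have lp := lin_pi_inv hlam.
rewrite /vert_map /ver_proj tmapE sw_tmap; last by linearity.
apply: sw_eq => a e /=.
rewrite -[linv_val _]/(val _) val_pi_inv //.
by rewrite (sw_push _ _ ((bilin_tensp _ _).2 _)).
Qed.

Lemma vert_map_explicit (a0 : A) (s : seq A) :
  tmap id (@linv_val k H OmH lam) (vert_map lam DA (dform (cal_in OmA) a0 s)) =
  ver_explicit OmH a0 s.
Proof.
have tr := trilin_ver_explicit_rec s.
rewrite val_vert_map -eval_rec_dform (vert_coact_in hDA).
rewrite /eval_rec /ver_explicit sweedler3_sw; last by linearity.
rewrite sw_tmap; last by linearity.
by apply: sw_eq => x h; rewrite lam_in_sw //; linearity.
Qed.

End Explicit.

Theorem proposition4p2p8 (k : fieldType) (H : hopf k)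
    (G : fodc H) (hG : bicovariant G)
    (OmH : calculus H) (hOmH : maximal_prolongation G OmH)
    (hDH : exists DH : OmH -> OmH \otimes OmH, extends_coproduct DH)
    (lamH : {linear OmH -> H \otimes OmH}) (hlamH : left_coaction lamH)
    (A : comodAlg H) (hA : quantum_principal_bundle A)
    (OmA : calculus A)
    (DA : OmA -> OmA \otimes OmH) (hDA : extends_coaction DA) :
  is_dga (ver lamH A) /\
  exists! pi_ver : OmA -> ver lamH A,
    [/\ dga_morphism pi_ver,
        forall v : ver lamH A, exists w : OmA, pi_ver w = v,
        forall a : A, pi_ver (cal_in OmA a) = a \ox to_linv lamH (dga_one OmH),
        forall (n : nat) (w : OmA), (0 < n)%N -> homog n w ->
          pi_ver w = ver_formula lamH DA n w &
        forall (a0 : A) (s : seq A),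
          tmap id (@linv_val k H OmH lamH) (pi_ver (dform (cal_in OmA) a0 s)) =
          ver_explicit OmH a0 s].
Proof.
have [hgal _] := hA.
split; first exact: ver_dga.
exists (vert_map lamH DA); split.
  split.
  - exact: vert_map_morphism.
  - exact: vert_map_surj.
  - exact: vert_map_in.
  - by move=> n w _; apply: vert_map_formula.
  - exact: vert_map_explicit.
(* Uniqueness: a linear map is known from its values on each degree, which
   are prescribed on A in degree 0 and by the formula in positive degrees. *)
move=> f [fm _ f_in f_formula _]; apply/funext => w.
have [pl _ _ _ _] := vert_map_morphism hlamH hDA.
have [fl _ _ _ _] := fm.
have [N ->] := dga_gr_sum (dga_ax OmA) w.
have lp : lin (vert_map lamH DA) by exact: pl.
have lf : lin f by exact: fl.
rewrite (lin_sum lp) (lin_sum lf); apply: eq_bigr => -[[|n] _] _ /=.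
  by rewrite -cal_prK f_in vert_map_in.
by rewrite (f_formula n.+1) ?(vert_map_formula hlamH hDA (n := n.+1)) //;
  apply: homog_gr.
Qed.
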